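(* There exists a universal constant $c>0$ such that the following holds. Let $n\ge 2$ and $t\ge 1$ be integers with $t\leq c\,\frac{n}{\log n}$. Let $F\subset S_n$ be a family of permutations of $[n]$ such that for all $\sigma,\tau\in F$, $|\{i\in[n]:\sigma(i)=\tau(i)\}|\neq t-1$. Then $|F|\leq (n-t)!$. Moreover, if \[ |F|>\left(1-\frac{1}{2(100t)^t}\right)\cdot (n-t)!, \] then there exist pairwise distinct $i_1,\ldots,i_t\in[n]$ and pairwise distinct $j_1,\ldots,j_t\in[n]$ such that $F\subset\{\sigma\in S_n:\sigma(i_1)=j_1,\ldots,\sigma(i_t)=j_t\}$.
   Context: $[n]=\{1,\ldots,n\}$ and $S_n$ is the set of all permutations of $[n]$. *)

(* Defs.v *)
From HB Require Import structures.
From mathcomp Require Import all_boot all_order all_algebra all_fingroup.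
From mathcomp Require Import reals exp.

Set Implicit Arguments.
Unset Strict Implicit.
Unset Printing Implicit Defensive.

(* [n] = {1, ..., n} is rendered as 'I_n = {0, ..., n-1}, and S_n as 'S_n. *)

Definition agreement (n : nat) (s u : 'S_n) : {set 'I_n} :=
  [set i | s i == u i].

(* The pairs (s, u) include s = u, whose agreement set is all of 'I_n. *)
Definition avoids_intersection (n k : nat) (F : {set 'S_n}) : Prop :=
  forall s u : 'S_n, s \in F -> u \in F -> #|agreement s u| <> k.

Definition perms_through (n t : nat) (i j : 'I_t -> 'I_n) : {set 'S_n} :=
  [set s : 'S_n | [forall k : 'I_t, s (i k) == j k]].

(* Main.v *)
Require Import Defs.
From HB Require Import structures.
From mathcomp Require Import all_boot all_order all_algebra all_fingroup.
From mathcomp Require Import reals exp.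
From mathcomp Require Import zify ring lra.

Set Implicit Arguments.
Unset Strict Implicit.
Unset Printing Implicit Defensive.

(** Identify a permutation with its graph, a set of [n] cells of the board
['I_n * 'I_n], and write [dens H X] for the density, inside the permutations
containing [X], of those members of [H] that contain [X].  If [X] maximizes
[dens H X / rho ^ #|X|] for a fixed [rho > 1] close to [1], then the members of
[H] through [X] are spread: fixing [m] more cells increases the density by a
factor at most [rho ^ m], so each further cell is used with probability at most
about [rho / n]; and [#|X| = O(t log n)], a small multiple of [n], if [H] has
density at least [n ^ (- O(t))].

Let [H1], [H2] be spread at [A], [B], with [#|A :&: B| < t].  Counting
incidences, some cell outside [A :|: B] has probability at least [1 / (2 n)] in
both families; add it to both sets and restore spreadness.  Repeat this until
[#|A :&: B| = t - 1], then enlarge [A] to [n / 100] cells.  Given [s] in [H1],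
the expected number of cells of [s] outside [A] used by a member of [H2] is about
[(1 - 1 / 100) * rho < 1], so some [u] in [H2] agrees with [s] on [A :&: B] only.
This is the forbidden intersection, hence the sets at which large parts of [F]
are spread form a [t]-intersecting family.

Shrinking the members of a [t]-intersecting family one size at a time leaves a
single [t]-set [T] and discards few permutations, so [F] contains more than
half of [ext T].  A large part of [F] outside [ext T] would be spread at some
set, which would have to contain [T]; so that part is tiny.  Finally a single
[s] of [F] outside [ext T] would exclude from [F] all the permutations of
[ext T] that meet [s] in exactly [t - 1] cells, and there are too many of them. *)

Lemma card_setIdE (T : finType) (A : {set T}) (P : pred T) :
  #|[set x in A | P x]| = (\sum_(x in A) P x)%N.
Proof.
rewrite -sum1_card (eq_bigl (fun x => (x \in A) && P x)) => [|x]; last by rewrite inE.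
by rewrite big_mkcondr; apply: eq_bigr => x _; case: (P x).
Qed.

(** * Permutations as sets of cells *)

Section Cells.
Variable n : nat.
Implicit Types (s u p : 'S_n) (X A B D : {set 'I_n * 'I_n}) (H F : {set 'S_n}).

Definition graph s : {set 'I_n * 'I_n} := [set d | s d.1 == d.2].

Definition ext X : {set 'S_n} := [set s | X \subset graph s].

Lemma in_graph s d : (d \in graph s) = (s d.1 == d.2).
Proof. by rewrite inE. Qed.

Lemma in_ext s X : (s \in ext X) = (X \subset graph s).
Proof. by rewrite inE. Qed.

Lemma fst_graph_inj s : {in graph s &, injective fst}.
Proof.
move=> [i j] [i' j']; rewrite !in_graph /= => /eqP <- /eqP <- /= ->.
by [].
Qed.

Lemma card_fst_graph s X : X \subset graph s -> #|fst @: X| = #|X|.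
Proof.
move=> Xs; apply: card_in_imset => d e dX eX.
by apply: (@fst_graph_inj s); apply: (subsetP Xs).
Qed.

Lemma graphE s : graph s = [set (i, s i) | i : 'I_n].
Proof.
apply/setP=> [[i j]]; rewrite in_graph /=; apply/eqP/imsetP => [<-|[k _ [-> ->]] //].
by exists i.
Qed.

Lemma card_graph s : #|graph s| = n.
Proof. by rewrite graphE card_imset ?card_ord // => i j []. Qed.

Lemma card_agreement s u : #|agreement s u| = #|graph s :&: graph u|.
Proof.
rewrite -(@card_in_imset _ _ fst (graph s :&: graph u)); last first.
  by move=> d e /setIP[ds _] /setIP[es _]; apply: fst_graph_inj ds es.
congr #|pred_of_set _|; apply/setP=> i; rewrite inE.
apply/eqP/imsetP => [e|[[k j]]].
  by exists (i, s i); rewrite ?inE /= ?e ?eqxx.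
by rewrite !inE /= => /andP[/eqP sk /eqP uk] ->; rewrite sk uk.
Qed.

Lemma extS X D : X \subset D -> ext D \subset ext X.
Proof. by move=> XD; apply/subsetP=> s; rewrite !inE; apply: subset_trans. Qed.

Lemma extU1 d X s : (s \in ext (d |: X)) = (d \in graph s) && (s \in ext X).
Proof. by rewrite !in_ext subUset sub1set. Qed.

(** The permutations through [X] are those fixing the rows of [X] pointwise, followed by [s]. *)
Lemma card_ext_eq X s : s \in ext X -> #|ext X| = (n - #|X|)`!.
Proof.
rewrite in_ext => Xs; pose I := fst @: X.
have cI : #|I| = #|X| := card_fst_graph Xs.
have -> : ext X = ([set p : 'S_n | perm_on (~: I) p] :* s)%g.
  apply/setP=> u; rewrite mem_rcoset !inE; apply/subsetP/subsetP => [Xu|/= H d dX].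
    move=> i; rewrite !inE; apply: contra => /imsetP[d dX ->]; apply/eqP.
    rewrite permM; apply: (canLR (permK s)); move: (Xu d dX) (subsetP Xs d dX).
    by rewrite !in_graph => /eqP -> /eqP ->.
  move: (subsetP Xs d dX); rewrite !in_graph => /eqP <-.
  have : d.1 \notin ~: I by rewrite inE negbK imset_f.
  move/(contra (H d.1)); rewrite unfold_in /= permM negbK => /eqP.
  by move/(canRL (permKV s)) => ->.
rewrite card_rcoset cardsE card_perm.
by rewrite -(addKn #|I| #|~: I|) cardsC card_ord cI.
Qed.

Lemma card_ext_le X : (#|ext X| <= (n - #|X|)`!)%N.
Proof.
have [->|[s sX]] := set_0Vmem (ext X); first by rewrite cards0.
by rewrite (card_ext_eq sX).
Qed.

(** * Permutations with a given number of agreements with [s] *)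

Lemma extU1_nonempty s X d : s \in ext X -> d.1 \notin fst @: X ->
  d.2 \notin snd @: X -> exists u, u \in ext (d |: X).
Proof.
rewrite in_ext => sX d1 d2; exists (s * tperm (s d.1) d.2)%g.
rewrite extU1 in_graph permM tpermL eqxx in_ext; apply/subsetP=> e eX.
have := subsetP sX e eX; rewrite !in_graph permM => /eqP se.
rewrite tpermD ?se //.
  by apply: contra d1 => /eqP; rewrite -se => /perm_inj ->; apply: imset_f.
by apply: contra d2 => /eqP ->; apply: imset_f.
Qed.

(* On average there is at most one hit, so at least half of the permutations have
   at most one; composing with a transposition removes a single hit, which
   bounds the number of permutations with one hit by twice that with none. *)
Lemma no_hit_count s X v : v \in ext X -> #|X| + 2 <= n ->
  (n - #|X|)`! <= 4 * #|[set u in ext X | graph u :&: graph s \subset X]|.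
Proof.
move=> vX Xn; set N := (n - #|X|)%N.
pose I := ~: (fst @: X).
have vX' : X \subset graph v by rewrite -in_ext.
have cI : #|I| = N by rewrite cardsCs setCK (card_fst_graph vX') card_ord.
pose hits u := [set i in I | u i == s i].
pose G0 := [set u in ext X | hits u == set0].
pose G1 i := [set u in ext X | hits u == [set i]].
have sG0 : #|G0| <= #|[set u in ext X | graph u :&: graph s \subset X]|.
  apply/subset_leq_card/subsetP=> u /setIdP[uX /eqP hu]; rewrite inE uX.
  apply/subsetP=> d /setIP[]; rewrite !in_graph => /eqP ud /eqP sd.
  have /setP/(_ d.1) := hu; rewrite !inE ud sd eqxx andbT => /negbFE/imsetP[e eX de].
  move: uX; rewrite in_ext => /subsetP/(_ e eX); rewrite in_graph -de ud => /eqP de2.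
  by rewrite [d]surjective_pairing de de2 -surjective_pairing.
apply: (@leq_trans (4 * #|G0|)); last by rewrite leq_mul2l sG0 orbT.
have swap i i' : i \in I -> i' \in I -> i' != i ->
    #|G1 i| <= #|[set u in G0 | u i' == s i]|.
  move=> iI i'I ii'; rewrite -(card_imset _ (mulgI (tperm i i'))).
  apply/subset_leq_card/subsetP=> _ /imsetP[u /setIdP[uX /eqP hu] ->].
  have ui : u i = s i by have /setP/(_ i) := hu; rewrite !inE eqxx => /andP[_ /eqP].
  rewrite inE permM tpermR ui eqxx andbT inE; apply/andP; split.
    rewrite in_ext; apply/subsetP=> e eX; rewrite in_graph permM.
    have eI : e.1 \notin I by rewrite inE negbK imset_f.
    rewrite tpermD; first by move: uX; rewrite in_ext => /subsetP/(_ e eX); rewrite in_graph.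
      by apply: contraNneq eI => <-.
    by apply: contraNneq eI => <-.
  apply/eqP/setP=> k; rewrite [RHS]inE; apply/negP => /setIdP[kI]; rewrite permM.
  case: tpermP => [ki|ki'|/eqP ki /eqP ki'].
  - by rewrite ki -ui (inj_eq perm_inj) (negbTE ii').
  - by rewrite ui ki' (inj_eq perm_inj) eq_sym (negbTE ii').
  move=> uk; have : k \in hits u by rewrite inE kI.
  by rewrite hu inE (negbTE ki).
(* Each row [i] has [N - 1] partners [i'] for [swap], and a given [u] takes the value [s i] in one
   row only. *)
have sum1 : (N - 1) * \sum_(i in I) #|G1 i| <= N * #|G0|.
  rewrite big_distrr /= -{2}cI -sum_nat_const; apply: leq_sum => i iI.
  apply: (@leq_trans (\sum_(i' in I :\ i) #|[set u in G0 | u i' == s i]|)).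
    have -> : N - 1 = #|I :\ i| by rewrite -cI (cardsD1 i I) iI addnC addnK.
    rewrite -sum_nat_const; apply: leq_sum => i' /setD1P[ii' i'I]; exact: swap.
  apply: (@leq_trans (\sum_i' #|[set u in G0 | u i' == s i]|)).
    by rewrite [X in _ <= X](bigID (mem (I :\ i))) leq_addr.
  under eq_bigr do rewrite card_setIdE.
  rewrite exchange_big -sum1_card; apply: leq_sum => u _.
  rewrite (bigD1 (u^-1 (s i))%g) //= permKV eqxx big1 // => j jn.
  by apply/eqP; rewrite eqb0; apply: contra jn => /eqP <-; rewrite permK.
have sum2 : \sum_(u in ext X) #|hits u| <= N`!.
  under eq_bigr do rewrite card_setIdE.
  rewrite exchange_big /=.
  have -> : N`! = \sum_(i in I) (N - 1)`!.
    rewrite sum_nat_const cI.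
    have : 0 < N by rewrite /N; move: Xn; clear; lia.
    by case: (N) => // m _; rewrite subn1 factS.
  apply: leq_sum => i iI; rewrite -card_setIdE.
  have iX : (i, s i) \notin X by move: iI; rewrite inE; apply: contra => /(imset_f fst).
  have -> : [set u in ext X | u i == s i] = ext ((i, s i) |: X).
    by apply/setP=> u; rewrite extU1 in_graph inE andbC.
  apply: leq_trans (card_ext_le _) _; rewrite cardsU1 iX add1n /N.
  by rewrite -subnDA addn1.
(* The three terms cover no hit, exactly one hit (together with the last term), and at least two
   hits. The sum gives [2 * N! <= 2 * #|G0| + 2 * #|G0| + N!]. *)
have pt : \sum_(u in ext X) 2 <= \sum_(u in ext X) (2 * (hits u == set0)
     + \sum_(i in I) (hits u == [set i]) + #|hits u|).
  apply: leq_sum => u _; have [->|[i ih]] := set_0Vmem (hits u).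
    by rewrite eqxx muln1 -addnA leq_addr.
  have iI : i \in I by case/setIdP: ih.
  have [h1|h1] := leqP 2 #|hits u|; first by apply: leq_trans h1 (leq_addl _ _).
  have c1 : #|hits u| = 1.
    by apply/eqP; rewrite eqn_leq -ltnS h1 card_gt0; apply/set0Pn; exists i.
  have /cards1P[j hj] : #|hits u| == 1 by rewrite c1.
  move: ih; rewrite hj => /set1P ij; rewrite cards1 -ij (bigD1 i) //= eqxx; lia.
move: pt; rewrite sum_nat_const (card_ext_eq vX) -/N !big_split /= big1_eq addn0.
rewrite -card_setIdE -/G0 exchange_big /=.
have -> : \sum_(i in I) \sum_(u in ext X) (hits u == [set i]) = \sum_(i in I) #|G1 i|.
  by apply: eq_bigr => i _; rewrite -card_setIdE.
move: sum1 sum2; set a := \sum_(i in I) #|G1 i|; set h := \sum_(u in _) _ => sum1 sum2 pt.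
have le : a <= 2 * #|G0|.
  have N1 : 0 < N - 1 by rewrite /N; move: Xn; clear; lia.
  rewrite -(leq_pmul2l N1) (leq_trans sum1) // mulnA leq_mul2r.
  by apply/orP; right; move: N1; clear; lia.
by move: pt sum2 le; clearbody a h; move: #|G0| (N`!) => g f; clear; lia.
Qed.

(** Induction on [u], forcing one more cell of [s] in a free row and column. At least
    [(n - #|X|) / 2] cells are available, and each [w] with [u.+1] hits arises from at most [u.+1]
    of them, whence the factor [2 ^ u * u!]. *)
Lemma hit_count s (u : nat) X v : v \in ext X -> 3 * (#|X| + u) <= n -> 3 <= n ->
  (n - #|X|)`! <= 4 * (2 ^ u * u`!)
    * #|[set w in ext X | #|(graph w :&: graph s) :\: X| == u]|.
Proof.
elim: u X v => [|u IH] X v vX Xn n3.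
  rewrite expn0 fact0 !muln1.
  apply: leq_trans (no_hit_count s vX _) _; first by move: Xn n3; clear; lia.
  rewrite leq_mul2l /=; apply/subset_leq_card/subsetP=> w; rewrite !inE.
  by rewrite cards_eq0 setD_eq0.
pose I := fst @: X; pose J := snd @: X.
have vX' : X \subset graph v by rewrite -in_ext.
pose S := [set d in graph s | (d.1 \notin I) && (d.2 \notin J)].
have cS : n - #|X| <= 2 * #|S|.
  have sub : graph s \subset S :|: [set (i, s i) | i in I] :|: [set ((s^-1)%g j, j) | j in J].
    apply/subsetP=> d ds; rewrite !in_setU [d \in S]inE ds /=.
    have sd : d.2 = s d.1 by move: ds; rewrite in_graph => /eqP.
    have [d1|_] /= := boolP (d.1 \in I).
      apply/orP; left; apply/imsetP; exists d.1 => //.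
      by rewrite -sd -surjective_pairing.
    have [d2|//] /= := boolP (d.2 \in J).
    apply/orP; right; apply/imsetP; exists d.2 => //.
    by rewrite {1}sd permK -surjective_pairing.
  have := subset_leq_card sub; rewrite card_graph => /leq_trans/(_ (leq_card_setU _ _)).
  move/leq_trans/(_ (leq_add (leq_card_setU _ _) (leqnn _))).
  have h1 : #|[set (i, s i) | i in I]| <= #|X| := leq_trans (leq_imset_card (fun i => (i, s i)) I) (leq_imset_card fst X).
  have h2 : #|[set ((s^-1)%g j, j) | j in J]| <= #|X| := leq_trans (leq_imset_card (fun j => ((s^-1)%g j, j)) J) (leq_imset_card snd X).
  move: h1 h2 Xn; move: #|[set (i, s i) | i in I]| #|[set ((s^-1)%g j, j) | j in J]| #|S| #|X|.
  by clear=> p q r x; lia.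
have SX d : d \in S -> d \notin X.
  by case/setIdP=> _ /andP[+ _]; apply: contra => /(imset_f fst).
pose hits w (Y : {set 'I_n * 'I_n}) := (graph w :&: graph s) :\: Y.
pose A k (Y : {set 'I_n * 'I_n}) := [set w in ext Y | #|hits w Y| == k].
have sum : \sum_(d in S) #|A u (d |: X)| <= u.+1 * #|A u.+1 X|.
  apply: (@leq_trans (\sum_(d in S) \sum_(w in A u.+1 X) (d \in hits w X))).
    apply: leq_sum => d dS; rewrite -card_setIdE; apply/subset_leq_card/subsetP=> w /setIdP[].
    have dX := SX d dS; have /setIdP[ds _] := dS.
    rewrite extU1 => /andP[dw wX] /eqP hw.
    have dh : d \in hits w X by rewrite inE dX inE dw.
    apply/setIdP; split=> //; apply/setIdP; split=> //; rewrite (cardsD1 d) dh add1n eqSS.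
    by rewrite -hw /hits setDDl setUC.
  rewrite exchange_big mulnC -sum_nat_const; apply: leq_sum => w /setIdP[_ /eqP <-].
  rewrite -sum1_card [X in _ <= X]big_mkcond /= big_mkcond; apply: leq_sum => d _.
  by case: (d \in S); case: (d \in hits w X).
have low : #|S| * (n - #|X|).-1`! <= 4 * (2 ^ u * u`!) * \sum_(d in S) #|A u (d |: X)|.
  rewrite -sum_nat_const big_distrr; apply: leq_sum => d dS.
  have /setIdP[_ /andP[d1 d2]] := dS.
  have [w wX] := extU1_nonempty vX d1 d2.
  have := IH _ _ wX; rewrite cardsU1 (SX d dS) add1n subnS; apply => //.
  by move: Xn; clear; lia.
have -> : (n - #|X|)`! = (n - #|X|) * (n - #|X|).-1`!.
  have : 0 < n - #|X| by move: Xn n3; clear; lia.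
  by case: (n - #|X|) => // m _; rewrite factS.
apply: (@leq_trans (2 * #|S| * (n - #|X|).-1`!)); first by rewrite leq_mul2r cS orbT.
rewrite -mulnA; apply: leq_trans (leq_mul (leqnn 2) (leq_trans low (leq_mul (leqnn _) sum))) _.
by apply: eq_leq; rewrite factS expnS -/(A u.+1 X); ring.
Qed.

End Cells.

(** * Estimates for powers, factorials and binomial coefficients *)

Lemma ffact_le_exp n m : n ^_ m <= n ^ m.
Proof.
elim: m n => [|m IH] n; first by rewrite ffactn0.
rewrite ffactnS expnS leq_mul2l; apply/orP; right.
by apply: leq_trans (IH _) _; case: m {IH} => // m; rewrite leq_exp2r ?leq_pred.
Qed.

Lemma ffact_ge_exp n m : (n - m) ^ m <= n ^_ m.
Proof.
elim: m n => [|m IH] n; first by rewrite ffactn0.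
rewrite ffactnS expnS leq_mul ?leq_subr //.
by have := IH n.-1; rewrite -subn1 -subnDA add1n.
Qed.

(** [m ^ m] is at most the falling factorial [C(2 m, m) m!], and the central binomial coefficient is
    at most [2 ^ (2 m)]. *)
Lemma exp_le_fact m : m ^ m <= 4 ^ m * m`!.
Proof.
have -> : m ^ m = ((m + m) - m) ^ m by rewrite addnK.
apply: leq_trans (ffact_ge_exp _ _) _; rewrite -bin_ffact leq_mul2r; apply/orP; right.
rewrite -[4]/(2 ^ 2) -expnM mul2n -addnn.
rewrite -[2]/(1 + 1) expnDn (bigD1 (inord m)) //=.
by rewrite inordK ?ltnS ?leq_addr // !exp1n !muln1 leq_addr.
Qed.

(** With [h = k - t] this bounds the count in [peel]: the choices of a [t]-subset of a [k]-set,
    times [h] branchings of degree [2 * h]. *)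
Lemma bin_mul_exp_le k h : 'C(k, h) * (2 * h) ^ h <= (8 * k) ^ h.
Proof.
rewrite expnMn mulnCA.
apply: (@leq_trans (2 ^ h * ('C(k, h) * (4 ^ h * h`!)))).
  by rewrite !leq_mul // exp_le_fact.
rewrite (mulnCA 'C(k, h)) bin_ffact mulnA -expnMn [(8 * k) ^ h]expnMn.
by rewrite leq_mul // ffact_le_exp.
Qed.

(** * Peeling an intersecting family by size *)

Section Peeling.
Variables (T : finType) (t : nat).
Implicit Types (A B C U X : {set T}) (M W : {set {set T}}).

Definition intersecting M := forall A B, A \in M -> B \in M -> t <= #|A :&: B|.

(* [M'] and [W] come from an inclusion-maximal [t]-intersecting family [N] of sets
   of size at most [k]: its members of size less than [k], and its minimal members
   of size [k].  A set [X] of size at least [t] properly contained in a member of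
   [W] is not in [N], so it meets some [C] in [N] in fewer than [t] points, and
   every member of [W] containing [X] contains one of the at most [2 * (k - t)]
   points of [C :\: X]. *)
Lemma peel k M : intersecting M -> (forall A, A \in M -> #|A| <= k) -> t < k ->
  exists M' W : {set {set T}}, [/\ intersecting M',
    (forall A, A \in M' -> #|A| < k), (forall A, A \in W -> #|A| = k),
    #|W| <= (8 * k) ^ (k - t) &
    forall A, A \in M -> exists2 U, U \in M' :|: W & U \subset A].
Proof.
move=> intM leM tk.
pose P (N : {set {set T}}) := [&& M \subset N, [forall A in N, #|A| <= k] &
  [forall A in N, forall B in N, t <= #|A :&: B|]].
have PM : P M.
  rewrite /P subxx /=; apply/andP; split; first by apply/forall_inP.
  by apply/forall_inP => A AM; apply/forall_inP => B BM; apply: intM.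
have [N /maxsetP[/and3P[MN /forall_inP leN /forall_inP intN'] maxN] _] := maxset_exists PM.
have intN (A B : {set T}) : A \in N -> B \in N -> t <= #|A :&: B|.
  by move=> AN BN; apply: (forall_inP (intN' A AN)).
pose W := [set A in N | (#|A| == k) && [forall U in N, ~~ (U \proper A)]].
have WN (A : {set T}) : A \in W -> A \in N by case/setIdP.
have Wk (A : {set T}) : A \in W -> #|A| = k by case/setIdP => _ /andP[/eqP].
exists [set A in N | #|A| < k], W; split=> //.
- by move=> A B /setIdP[AN _] /setIdP[BN _]; apply: intN.
- by move=> A /setIdP[].
- have [->|[A1 A1W]] := set_0Vmem W; first by rewrite cards0.
  (* [X] grows from a [t]-subset [U] of [A1] by one point per branching; at size [k] the only
     candidate left is [X] itself. *)
  have branch m (X U : {set T}) : U \subset A1 -> U \subset X -> #|U| = t -> #|X| + m = k ->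
      #|[set A in W | X \subset A]| <= (2 * (k - t)) ^ m.
    elim: m X => [|m IH] X UA1 UX cU cX.
      rewrite addn0 in cX; rewrite expn0 -(cards1 X) subset_leq_card //.
      apply/subsetP=> A /setIdP[AW XA]; rewrite inE eq_sym eqEcard XA.
      by rewrite (Wk _ AW) cX /=.
    have [->|[A0 /setIdP[A0W XA0]]] := set_0Vmem [set A in W | X \subset A].
      by rewrite cards0.
    have pX : X \proper A0 by rewrite properEcard XA0 (Wk _ A0W) -cX addnS ltnS leq_addr.
    have XN : X \notin N.
      have /setIdP[_ /andP[_ /forall_inP h]] := A0W.
      by apply/negP => /h; rewrite pX.
    have tX : t <= #|X| by rewrite -cU subset_leq_card.
    have [C CN CX] : exists2 C, C \in N & #|X :&: C| < t.
      apply/exists_inP; apply: contraNT XN; rewrite negb_exists_in => /forall_inP h.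
      have h' (C : {set T}) : C \in N -> t <= #|X :&: C| by move=> /h; rewrite -leqNgt.
      have <- : X |: N = N; last by rewrite setU11.
      apply: maxN (subsetUr _ _); apply/and3P; split.
      + by apply: subset_trans MN (subsetUr _ _).
      + apply/forall_inP => A /setU1P[->|/leN //].
        by rewrite -cX leq_addr.
      apply/forall_inP => A /setU1P[->|AN]; apply/forall_inP => B /setU1P[->|BN].
      + by rewrite setIid.
      + exact: h'.
      + by rewrite setIC; apply: h'.
      exact: intN.
    (* [C] meets [A1] in at least [t] points, at most [k - t] of them outside [U]; so at least
       [2 * t - k] of its at most [k] points lie in [U], hence in [X]. *)
    have cCX : #|C :\: X| <= 2 * (k - t).
      have h1 : #|C :&: U| <= #|C :&: X| by rewrite subset_leq_card ?setIS.
      have h2 := intN _ _ CN (WN _ A1W); have h3 := leN _ CN; have h4 := Wk _ A1W.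
      have h5 : #|C :&: A1| + #|U| <= #|A1| + #|C :&: U|.
        rewrite -(cardsUI (C :&: A1) U) -setIA (setIidPr UA1) leq_add2r.
        by rewrite subset_leq_card // subUset subsetIr.
      have h6 := cardsID X C.
      by move: h1 h2 h3 h4 h5 h6 cU tk; clear; lia.
    have sub : [set A in W | X \subset A]
        \subset \bigcup_(x in C :\: X) [set A in W | x |: X \subset A].
      apply/subsetP=> A /setIdP[AW XA].
      have /subsetPn[x xA xX] : ~~ (A :&: C \subset X).
        apply/negP => sX; have := intN _ _ (WN _ AW) CN; rewrite leqNgt.
        apply/negP; rewrite negbK; apply: leq_ltn_trans CX.
        by rewrite subset_leq_card // subsetI sX subsetIr.
      have [xA' xC] := setIP xA.
      apply/bigcupP; exists x; first by rewrite inE xX xC.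
      by rewrite inE AW subUset sub1set xA' XA.
    apply: leq_trans (subset_leq_card sub) _.
    apply: (@leq_trans (\sum_(x in C :\: X) (2 * (k - t)) ^ m)); last first.
      by rewrite sum_nat_const expnS leq_mul2r cCX orbT.
    elim/big_rec2: _ => [|x y Y xCX le]; first by rewrite cards0.
    apply: leq_trans (leq_card_setU _ _) _; rewrite leq_add //.
    apply: IH => //; first by apply: subset_trans UX (subsetUr _ _).
    have [_ xX] := setDP xCX.
    by rewrite cardsU1 xX add1n addSnnS.
  pose D := [set U : {set T} | U \subset A1 & #|U| == t].
  have sub : W \subset \bigcup_(U in D) [set A in W | U \subset A].
    apply/subsetP=> A AW; have tA := intN _ _ (WN _ A1W) (WN _ AW).
    have : 0 < #|[set U : {set T} | U \subset A1 :&: A & #|U| == t]|.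
      by rewrite cards_draws bin_gt0.
    case/card_gt0P => U; rewrite inE subsetI => /andP[/andP[UA1 UA] cU].
    by apply/bigcupP; exists U; rewrite inE ?UA1 ?AW.
  apply: leq_trans (subset_leq_card sub) _.
  apply: (@leq_trans (\sum_(U in D) (2 * (k - t)) ^ (k - t))).
    elim/big_rec2: _ => [|U y Y /setIdP[UA1 /eqP cU] le]; first by rewrite cards0.
    apply: leq_trans (leq_card_setU _ _) _; rewrite leq_add //.
    by apply: (branch _ _ U) => //; rewrite cU subnKC // ltnW.
  rewrite sum_nat_const cards_draws (Wk _ A1W) -bin_sub ?(ltnW tk) //.
  exact: bin_mul_exp_le.
move=> A AM; have AN := subsetP MN A AM.
pose Q (U : {set T}) := (U \in N) && (U \subset A).
have QA : Q A by rewrite /Q AN subxx.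
case: (@arg_minnP _ A Q (fun U => #|U|) QA) => U /andP[UN UA] minU.
exists U => //; rewrite !inE UN /=; case: ltngtP (leN _ UN) => //= cU _.
apply/forall_inP => V VN; apply/negP => VU.
have := minU V; rewrite /Q VN (subset_trans (proper_sub VU) UA) => /(_ isT).
by rewrite leqNgt proper_card.
Qed.

End Peeling.

Import Order.TTheory GRing.Theory Num.Theory.
Local Open Scope ring_scope.

(** The permutations through the sets that [peel] discards at size [t + h] are at most a share
    [1 / 2 ^ (h + 2)] of [(n - t)!]. The constant 65 leaves [64 * (t + h) <= n - (t + h)], where a
    factor 8 pays for [2 ^ (h + 2) <= 8 ^ h]. *)
Lemma peel_fact (n t h : nat) : (65 * (t + h) <= n)%N -> (0 < h)%N ->
  ((8 * (t + h)) ^ h * (n - (t + h))`! * 2 ^ (h + 2) <= (n - t)`!)%N.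
Proof.
move=> le h0; set k := (t + h)%N in le *.
have hn : (h <= n - t)%N by move: le; rewrite /k; clear; lia.
have e : (n - t - h)%N = (n - k)%N by rewrite /k subnDA.
rewrite -(ffact_fact hn) e mulnAC leq_mul2r; apply/orP; right.
apply: leq_trans (ffact_ge_exp (n - t) h); rewrite e.
apply: (@leq_trans ((8 * k) ^ h * 8 ^ h)%N).
  rewrite leq_mul2l; apply/orP; right.
  by rewrite (_ : 8 = 2 ^ 3)%N // -expnM leq_exp2l //; move: h0; clear; lia.
by rewrite -expnMn leq_exp2r //; move: le; clear; lia.
Qed.

(** * Densities and spread families *)

Section Spread.
Variables (R : realFieldType) (n : nat).
Implicit Types (s u : 'S_n) (A B D S X T : {set 'I_n * 'I_n}) (H : {set 'S_n}).
Implicit Types (K b : R).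

Definition dens H X : R := #|H :&: ext X|%:R / ((n - #|X|)`!)%:R.

(* Any constant close enough to 1 would do. *)
Definition rho : R := 1001 / 1000.

(** The slack [K] collects the constant factors lost on passing to subfamilies, while the rate [rho]
    stays fixed. *)
Definition spread K H A :=
  forall D, A \subset D -> dens H D <= K * rho ^+ (#|D| - #|A|) * dens H A.

Lemma rho_gt0 : 0 < rho. Proof. by rewrite /rho; lra. Qed.
Lemma rho_ge1 : 1 <= rho. Proof. by rewrite /rho; lra. Qed.

Lemma factR_gt0 m : 0 < (m`!)%:R :> R. Proof. by rewrite ltr0n fact_gt0. Qed.

Lemma dens_ge0 H X : 0 <= dens H X.
Proof. by rewrite divr_ge0 // ler0n. Qed.

Lemma dens_le1 H X : dens H X <= 1.
Proof.
rewrite ler_pdivrMr ?factR_gt0 // mul1r ler_nat.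
by apply: leq_trans (card_ext_le X); rewrite subset_leq_card ?subsetIr.
Qed.

Lemma dens_mono H H' X : H \subset H' -> dens H X <= dens H' X.
Proof.
by move=> HH'; rewrite ler_pM2r ?invr_gt0 ?factR_gt0 // ler_nat subset_leq_card ?setSI.
Qed.

Lemma dens_setI H A D : A \subset D -> dens (H :&: ext A) D = dens H D.
Proof. by move=> AD; rewrite /dens -setIA (setIidPr (extS AD)). Qed.

Lemma dens_gt0P H X : reflect (exists2 s, s \in H & s \in ext X) (0 < dens H X).
Proof.
rewrite pmulr_lgt0 ?invr_gt0 ?factR_gt0 // ltr0n card_gt0.
by apply: (iffP (set0Pn _)) => [[s /setIP[sH sX]]|[s sH sX]]; exists s => //; apply/setIP.
Qed.

Lemma spread_mono K K' H A : K <= K' -> spread K H A -> spread K' H A.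
Proof.
move=> KK' gH D /gH /le_trans; apply; rewrite ler_wpM2r ?dens_ge0 //.
by rewrite ler_wpM2r // exprn_ge0 // ltW ?rho_gt0.
Qed.

Lemma spread_setI K H A : spread K H A -> spread K (H :&: ext A) A.
Proof. by move=> gH D AD; rewrite !dens_setI //; apply: gH. Qed.

(** [A'] maximizes [dens H D / rho ^+ #|D|] over the supersets [D] of [A]; this ratio is at least
    [b] at [A]. *)
Lemma spread_exists b H A : 0 < b -> b * rho ^+ #|A| <= dens H A ->
  exists A', [/\ A \subset A', b * rho ^+ #|A'| <= dens H A' & spread 1 H A'].
Proof.
move=> b0 bA; pose f D : R := dens H D / rho ^+ #|D|.
have r0 D : 0 < rho ^+ #|D| by rewrite exprn_gt0 ?rho_gt0.
case: (@arg_maxP _ _ _ A (fun D => A \subset D) f (subxx A)) => A' AA' max.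
have fA : b <= f A' by apply: le_trans (max A (subxx A)); rewrite ler_pdivlMr.
exists A'; split=> //; first by rewrite -ler_pdivlMr.
move=> D A'D; have fD : dens H D <= f A' * rho ^+ #|D|.
  by rewrite -ler_pdivrMr //; apply: max (subset_trans AA' A'D).
apply: le_trans fD _; rewrite mul1r mulrC /f mulrA mulrAC ler_wpM2r ?dens_ge0 //.
by rewrite ler_pdivrMr // -exprD subnK ?subset_leq_card.
Qed.

Lemma dens_setU1 H A d : H \subset ext A -> d \notin A -> (#|A| < n)%N ->
  dens H (d |: A)
    = (n - #|A|)%:R * #|[set s in H | d \in graph s]|%:R / ((n - #|A|)`!)%:R.
Proof.
move=> HA dA nA; rewrite /dens cardsU1 dA add1n.
have -> : H :&: ext (d |: A) = [set s in H | d \in graph s].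
  apply/setP=> s; rewrite !inE; case sH: (s \in H) => //=.
  have := subsetP HA _ sH; rewrite in_ext => sA.
  by rewrite subUset sub1set sA andbT inE.
rewrite -(subnSK nA) factS natrM.
by rewrite -mulf_div divff ?mul1r // (subnSK nA) pnatr_eq0 -lt0n subn_gt0.
Qed.

(** Spreadness with [D = d |: A]. For [n <= #|A|] the left side is 0, and [D = A] shows that the
    right side is nonnegative. *)
Lemma spread_cell K H A d : H \subset ext A -> spread K H A -> d \notin A ->
  (n - #|A|)%:R * #|[set s in H | d \in graph s]|%:R <= K * rho * #|H|%:R.
Proof.
move=> HA gH dA; have [nA|nA] := leqP n #|A|.
  have -> : (n - #|A| = 0)%N by apply/eqP; rewrite subn_eq0.
  rewrite mul0r; have := gH A (subxx A); rewrite subnn expr0 mulr1.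
  move: (dens_ge0 H A); rewrite /dens (setIidPl HA) => h.
  have f0 := factR_gt0 (n - #|A|); have h0 : 0 <= #|H|%:R :> R by rewrite ler0n.
  rewrite mulrA ler_pM2r ?invr_gt0 // => h1.
  have k0 : 0 <= K * #|H|%:R by apply: le_trans h1.
  by rewrite mulrAC mulr_ge0 // ltW ?rho_gt0.
have := gH (d |: A) (subsetUr _ _); rewrite dens_setU1 // cardsU1 dA addnK expr1.
by rewrite /dens (setIidPl HA) [leRHS]mulrA ler_pM2r ?invr_gt0 ?factR_gt0.
Qed.

(** * Subfamilies that avoid a set of cells *)

Definition avoiding S H : {set 'S_n} := [set s in H | [disjoint graph s & S]].

Lemma avoiding_sub S H : avoiding S H \subset H.
Proof. by apply/subsetP=> s /setIdP[]. Qed.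

(** Union bound over the cells of [S], each controlled by [spread_cell]. *)
Lemma card_avoiding K H A S : H \subset ext A -> spread K H A ->
    [disjoint S & A] ->
  ((n - #|A|)%:R - #|S|%:R * (K * rho)) * #|H|%:R
    <= (n - #|A|)%:R * #|avoiding S H|%:R.
Proof.
move=> HA gH SA.
have sub : H :\: avoiding S H \subset \bigcup_(d in S) [set s in H | d \in graph s].
  apply/subsetP=> s; rewrite !inE => /andP[+ sH]; rewrite sH /= => /pred0Pn[d /andP[ds dS]].
  by apply/bigcupP; exists d => //; rewrite inE sH.
have le1 : (#|H| <= #|avoiding S H| + \sum_(d in S) #|[set s in H | d \in graph s]|)%N.
  rewrite -(cardsID (avoiding S H) H) (setIidPr (avoiding_sub _ _)) leq_add2l.
  apply: leq_trans (subset_leq_card sub) _.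
  elim/big_rec2: _ => [|d y X dS le]; first by rewrite cards0.
  by apply: leq_trans (leq_card_setU _ _) _; rewrite leq_add2l.
have le2 : (n - #|A|)%:R * (\sum_(d in S) #|[set s in H | d \in graph s]|)%N%:R
    <= #|S|%:R * (K * rho) * #|H|%:R :> R.
  rewrite natr_sum mulr_sumr -mulrA [leRHS]mulr_natl -sumr_const; apply: ler_sum => d dS.
  by apply: spread_cell => //; move/pred0P: SA => /(_ d); rewrite /= dS => /negbT.
move: le1; rewrite -(ler_nat R) natrD => le1.
have := ler_wpM2l (ler0n R (n - #|A|)) le1; rewrite mulrDr mulrBl.
by move: le2; lra.
Qed.

(** Densities at supersets of [A] can only drop, while the one at [A] keeps a factor [c] by the
    union bound; so the slack grows by [1 / c]. *)
Lemma spread_avoiding (c : R) K H A S : 0 < c -> 0 <= K -> H \subset ext A ->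
    spread K H A -> [disjoint S & A] -> (#|A| < n)%N ->
    #|S|%:R * (K * rho) <= (1 - c) * (n - #|A|)%:R ->
  c * dens H A <= dens (avoiding S H) A /\ spread (K / c) (avoiding S H) A.
Proof.
move=> c0 K0 HA gH SA An le.
have dc : c * dens H A <= dens (avoiding S H) A.
  rewrite /dens mulrA ler_pM2r ?invr_gt0 ?factR_gt0 // (setIidPl HA).
  rewrite (setIidPl (subset_trans (avoiding_sub _ _) HA)).
  have a0 : 0 < (n - #|A|)%:R :> R by rewrite ltr0n subn_gt0.
  rewrite -(ler_pM2l a0); apply: le_trans (card_avoiding HA gH SA).
  rewrite [leLHS]mulrA ler_wpM2r ?ler0n //; lra.
split=> // D AD; apply: le_trans (dens_mono D (avoiding_sub S H)) _.
apply: le_trans (gH D AD) _.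
have -> : K / c * rho ^+ (#|D| - #|A|) * dens (avoiding S H) A
   = K * rho ^+ (#|D| - #|A|) * (c^-1 * dens (avoiding S H) A) by ring.
apply: ler_wpM2l; first by rewrite mulr_ge0 // exprn_ge0 // ltW ?rho_gt0.
by rewrite ler_pdivlMl.
Qed.

(** * Small base sets and confined pairs of families *)

Hypothesis n_big : (1000 <= n)%N.

(* As densities are at most 1, [b * rho ^+ #|A| <= dens H A] with [small b]
   bounds [#|A|] by [n / 1000]. *)
Definition small b := 0 < b /\ forall m, b * rho ^+ m <= 1 -> (1000 * m <= n)%N.

Lemma small_mono b b' : b <= b' -> small b -> small b'.
Proof.
move=> bb [b0 sb]; split=> [|m h]; first exact: lt_le_trans bb.
by apply: sb; apply: le_trans h; rewrite ler_wpM2r // exprn_ge0 // ltW ?rho_gt0.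
Qed.

Lemma small_card b H A : small b -> b * rho ^+ #|A| <= dens H A ->
  (1000 * #|A| <= n)%N.
Proof. by move=> [b0 sb] h; apply: sb; apply: le_trans h (dens_le1 _ _). Qed.

Lemma dens_ge_gt0 b H A : 0 < b -> b * rho ^+ #|A| <= dens H A -> 0 < dens H A.
Proof. by move=> b0; apply: lt_le_trans; rewrite mulr_gt0 // exprn_gt0 ?rho_gt0. Qed.

(** Given [confined A B H1] and [confined B A H2], a member of [H1] through [A] and one of [H2]
    through [B] agree inside [A :|: B] exactly on [A :&: B]. *)
Definition confined A B H := forall s, s \in H -> graph s :&: B \subset A.

Lemma confined_sub A B H H' : H' \subset H -> confined A B H -> confined A B H'.
Proof. by move=> /subsetP h c s /h /c. Qed.

Lemma confinedSl A A' B H : A \subset A' -> confined A B H -> confined A' B H.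
Proof. by move=> h c s /c /subset_trans; apply. Qed.

Lemma confined_avoiding A B H : confined A B (avoiding (B :\: A) H).
Proof.
move=> s /setIdP[_ /pred0P dis]; apply/subsetP=> d /setIP[ds dB].
by have := dis d; rewrite /= ds inE dB andbT => /negbFE.
Qed.

Lemma disjointD A B : [disjoint B :\: A & A].
Proof. by apply/pred0P=> d /=; rewrite inE andbAC andNb. Qed.

(* After [H2] is made to avoid [A :\: B], spreadness is restored by enlarging [B],
   and [H1] must then avoid the new cells; the spread bounds make both losses
   constant factors. *)
Lemma absorb b A B H1 H2 : small (b / 2) -> (40 * #|A| <= n)%N ->
    H1 \subset ext A -> H2 \subset ext B -> confined A B H1 ->
    spread (1 : R) H1 A -> spread (16 : R) H2 B -> b * rho ^+ #|B| <= dens H2 B ->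
  exists B' H1' H2',
   [/\ [/\ B \subset B', H1' \subset H1, H2' \subset H2 & A :&: B' = A :&: B],
       [/\ H2' \subset ext B', confined A B' H1' & confined B' A H2'],
       [/\ spread (100 / 99 : R) H1' A & spread (1 : R) H2' B'] &
       99 / 100 * dens H1 A <= dens H1' A /\ b / 2 * rho ^+ #|B'| <= dens H2' B'].
Proof.
move=> sb A40 H1A H2B cB g1 g2 d2.
have b20 : 0 < b / 2 := sb.1.
have rE : rho = 1001 / 1000 by [].
have B1000 : (1000 * #|B| <= n)%N.
  apply: (@small_card b _ _ (small_mono _ sb)) d2; lra.
have Bn : (#|B| < n)%N by move: n_big B1000; clear; lia.
have An : (#|A| < n)%N by move: n_big A40; clear; lia.
(* The expected number of cells of [A :\: B] used is bounded by about [16 / 40], below one half. *)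
have le1 : #|A :\: B|%:R * (16 * rho) <= (1 - 1 / 2) * (n - #|B|)%:R :> R.
  have le : (#|A :\: B| <= #|A|)%N by rewrite subset_leq_card ?subsetDl.
  have h1 : (40 * #|A :\: B|)%:R <= n%:R :> R by rewrite ler_nat; move: le A40; clear; lia.
  have h2 : (1000 * n)%:R <= (1002 * (n - #|B|))%:R :> R by rewrite ler_nat; move: B1000; clear; lia.
  by have n0 := ler0n R n; rewrite !natrM in h1 h2; rewrite rE; lra.
have half0 : 0 < 1 / 2 :> R by rewrite divr_gt0.
have [d2' g2'] := spread_avoiding half0 (ler0n R 16) H2B g2 (disjointD B A) Bn le1.
set H2o := avoiding _ _ in d2' g2'.
have d2o : b / 2 * rho ^+ #|B| <= dens H2o B.
  by move: d2 d2'; set x := _ ^+ _; lra.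
have [B' [BB' dB' gB']] := spread_exists b20 d2o.
have B'1000 := small_card sb dB'.
have le2 : #|B' :\: A|%:R * (1 * rho) <= (1 - 99 / 100) * (n - #|A|)%:R :> R.
  have le : (#|B' :\: A| <= #|B'|)%N by rewrite subset_leq_card ?subsetDl.
  have h1 : (1000 * #|B' :\: A|)%:R <= n%:R :> R by rewrite ler_nat; move: le B'1000; clear; lia.
  have h2 : (39 * n)%:R <= (40 * (n - #|A|))%:R :> R by rewrite ler_nat; move: A40; clear; lia.
  by have n0 := ler0n R n; rewrite !natrM in h1 h2; rewrite rE; lra.
have c0 : 0 < 99 / 100 :> R by rewrite divr_gt0.
have [d1' g1'] := spread_avoiding c0 ler01 H1A g1 (disjointD A B') An le2.
have cH2 : confined B' A (H2o :&: ext B').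
  by apply: confined_sub (subsetIl _ _) _; apply: confinedSl BB' _; apply: confined_avoiding.
exists B', (avoiding (B' :\: A) H1), (H2o :&: ext B'); split; split.
- exact: BB'.
- exact: avoiding_sub.
- by apply: subset_trans (subsetIl _ _) (avoiding_sub _ _).
(* Some member of [H2] contains [B'] and avoids [A :\: B], so [B'] gains no cell of [A]. *)
- apply/eqP; rewrite eqEsubset; apply/andP; split; last exact: setIS.
  rewrite subsetI subsetIl /=.
  have /dens_gt0P[u uH uB'] := dens_ge_gt0 b20 dB'.
  have /(_ u uH) cu := @confined_avoiding B A H2.
  apply: subset_trans cu; rewrite setIC setSI //.
  by rewrite in_ext in uB'.
- exact: subsetIr.
- exact: confined_avoiding.
- exact: cH2.
- by apply: spread_mono g1'; lra.
- exact: spread_setI.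
- exact: d1'.
- by rewrite dens_setI.
Qed.

(** * Linked pairs: the invariant under which [A :&: B] grows cell by cell *)

Record linked b A B H1 H2 : Prop := Linked {
  linked_ext1 : H1 \subset ext A;
  linked_ext2 : H2 \subset ext B;
  linked_conf1 : confined A B H1;
  linked_conf2 : confined B A H2;
  linked_spread1 : spread (16 : R) H1 A;
  linked_spread2 : spread (16 : R) H2 B;
  linked_dens1 : b * rho ^+ #|A| <= dens H1 A;
  linked_dens2 : b * rho ^+ #|B| <= dens H2 B
}.

(** A member of [H] contains [A] and meets [B] only inside [A], so it has exactly [n - #|A|] cells
    outside [A :|: B]. *)
Lemma sum_cells A B H : H \subset ext A -> confined A B H ->
  (\sum_(d in ~: (A :|: B)) #|[set s in H | d \in graph s]| = (n - #|A|) * #|H|)%N.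
Proof.
move=> HA cH.
have -> : (\sum_(d in ~: (A :|: B)) #|[set s in H | d \in graph s]|
  = \sum_(s in H) #|graph s :\: (A :|: B)|)%N.
  transitivity (\sum_(d in ~: (A :|: B)) \sum_(s in H) (d \in graph s))%N.
    apply: eq_bigr => d _; rewrite -sum1_card big_mkcond [RHS]big_mkcond.
    by apply: eq_bigr => s _; rewrite !inE; case: (s \in H); case: (_ == _).
  rewrite exchange_big; apply: eq_bigr => s _.
  rewrite -sum1_card big_mkcond [RHS]big_mkcond.
  by apply: eq_bigr => d _; rewrite !inE; case: (_ || _); case: (_ == _).
rewrite mulnC -sum_nat_const; apply: eq_bigr => s sH.
have -> : graph s :\: (A :|: B) = graph s :\: A.
  apply/setP=> d; rewrite !in_setD in_setU negb_or -andbA; case dA: (d \in A) => //=.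
  case ds: (d \in graph s); rewrite ?andbF ?andbT //.
  apply/negP => dB; have /subsetP/(_ d) := cH s sH.
  by rewrite inE ds dB dA => /(_ isT).
have := subsetP HA s sH; rewrite in_ext => sA.
by rewrite cardsD (setIidPr sA) card_graph.
Qed.

(** Otherwise every outside cell has probability below [1 / (2 n)] in one family and at most
    [1.1 / n] in the other. Over at most [n ^ 2] cells this sums to at most [1.6 n], whereas
    [sum_cells] gives nearly [2 n]. *)
Lemma common_cell A B H1 H2 : (1000 * #|A| <= n)%N -> (1000 * #|B| <= n)%N ->
    H1 \subset ext A -> H2 \subset ext B -> confined A B H1 -> confined B A H2 ->
    spread (100 / 99 : R) H1 A -> spread (100 / 99 : R) H2 B ->
    (0 < #|H1|)%N -> (0 < #|H2|)%N ->
  exists2 d, d \notin A :|: B &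
    (#|H1| <= 2 * n * #|[set s in H1 | d \in graph s]|)%N /\
    (#|H2| <= 2 * n * #|[set s in H2 | d \in graph s]|)%N.
Proof.
move=> sA sB H1A H2B c1 c2 g1 g2 p1 p2.
pose f1 d := #|[set s in H1 | d \in graph s]|.
pose f2 d := #|[set s in H2 | d \in graph s]|.
have [/existsP[d /and3P[dM h1 h2]]|/existsPn no] :=
  boolP [exists d, [&& d \notin A :|: B, #|H1| <= 2 * n * f1 d & #|H2| <= 2 * n * f2 d]]%N.
  by exists d.
have n0 : 0 < n%:R :> R by rewrite ltr0n; move: n_big; clear; lia.
have P1 : 0 < #|H1|%:R :> R by rewrite ltr0n.
have P2 : 0 < #|H2|%:R :> R by rewrite ltr0n.
have a1 : 999 * n%:R <= 1000 * (n - #|A|)%:R :> R.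
  by rewrite -!natrM ler_nat; move: sA; clear; lia.
have a2 : 999 * n%:R <= 1000 * (n - #|B|)%:R :> R.
  by rewrite -!natrM ler_nat; move: sB; clear; lia.
have rE : rho = 1001 / 1000 by [].
have s1 := sum_cells H1A c1; have s2 := sum_cells H2B c2; rewrite setUC in s2.
have le d : d \in ~: (A :|: B) ->
    n%:R * ((f1 d)%:R * #|H2|%:R + (f2 d)%:R * #|H1|%:R) <= 8 / 5 * (#|H1|%:R * #|H2|%:R) :> R.
  rewrite in_setC => dM; have := no d; rewrite dM /=.
  have /andP[dA dB] : (d \notin A) && (d \notin B) by rewrite -negb_or -in_setU.
  have := spread_cell H1A g1 dA; have := spread_cell H2B g2 dB; rewrite -/(f1 d) -/(f2 d).
  rewrite rE => b2 b1.
  have b1' : n%:R * (f1 d)%:R <= 11 / 10 * #|H1|%:R :> R.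
    have : 999 * n%:R * (f1 d)%:R <= 1000 * (n - #|A|)%:R * (f1 d)%:R :> R by rewrite ler_wpM2r.
    by move: b1 P1; clear; lra.
  have b2' : n%:R * (f2 d)%:R <= 11 / 10 * #|H2|%:R :> R.
    have : 999 * n%:R * (f2 d)%:R <= 1000 * (n - #|B|)%:R * (f2 d)%:R :> R by rewrite ler_wpM2r.
    by move: b2 P2; clear; lra.
  have e1 := ler_wpM2r (ltW P2) b1'; have e2 := ler_wpM2r (ltW P1) b2'.
  rewrite negb_and -!ltnNge => /orP[] h.
    have h' : (2 * n%:R * (f1 d)%:R) * #|H2|%:R <= #|H1|%:R * #|H2|%:R :> R.
      by rewrite ler_wpM2r // -!natrM ler_nat ltnW.
    by move: e2 h'; clear; lra.
  have h' : (2 * n%:R * (f2 d)%:R) * #|H1|%:R <= #|H2|%:R * #|H1|%:R :> R.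
    by rewrite ler_wpM2r // -!natrM ler_nat ltnW.
  by move: e1 h'; clear; lra.
have := ler_sum (index_enum _) le.
rewrite sumr_const -mulr_sumr big_split /= -!mulr_suml -!natr_sum s1 s2 !natrM -mulr_natl.
have cM : #|~: (A :|: B)|%:R <= n%:R * n%:R :> R.
  by rewrite -natrM ler_nat (leq_trans (max_card _)) // card_prod card_ord.
have P12 := mulr_gt0 P1 P2 => h.
have h1 : #|~: (A :|: B)|%:R * (8 / 5 * (#|H1|%:R * #|H2|%:R)) <= n%:R * n%:R * (8 / 5 * (#|H1|%:R * #|H2|%:R)) :> R.
  by rewrite ler_wpM2r // mulr_ge0 ?divr_ge0 // ltW.
have h2 : n%:R * (#|H1|%:R * #|H2|%:R) * (999 * n%:R) <= n%:R * (#|H1|%:R * #|H2|%:R) * (1000 * (n - #|A|)%:R) :> R.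
  by rewrite ler_wpM2l // mulr_ge0 // ltW.
have h3 : n%:R * (#|H1|%:R * #|H2|%:R) * (999 * n%:R) <= n%:R * (#|H1|%:R * #|H2|%:R) * (1000 * (n - #|B|)%:R) :> R.
  by rewrite ler_wpM2l // mulr_ge0 // ltW.
have h4 : 0 < n%:R * n%:R * (#|H1|%:R * #|H2|%:R) :> R by rewrite !mulr_gt0.
by exfalso; move: h h1 h2 h3 h4; clear; lra.
Qed.

Lemma dens_cell A H d : (1000 * #|A| <= n)%N -> H \subset ext A -> d \notin A ->
    (#|H| <= 2 * n * #|[set s in H | d \in graph s]|)%N ->
  49 / 100 * dens H A <= dens H (d |: A).
Proof.
move=> sA HA dA le.
have An : (#|A| < n)%N by move: n_big sA; clear; lia.
rewrite dens_setU1 // /dens (setIidPl HA) mulrA ler_pM2r ?invr_gt0 ?factR_gt0 //.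
have a1 : 999 * n%:R <= 1000 * (n - #|A|)%:R :> R.
  by rewrite -!natrM ler_nat; move: sA; clear; lia.
set x := #|[set _ in _ | _]| in le *.
have h1 : #|H|%:R <= 2 * n%:R * x%:R :> R by rewrite -!natrM ler_nat.
have h2 : 999 * n%:R * x%:R <= 1000 * (n - #|A|)%:R * x%:R :> R by rewrite ler_wpM2r.
have h3 := ler0n R #|H|.
by move: h1 h2 h3; clear; lra.
Qed.

(** One factor [rho] moves into the slack, together with the loss [c] in density from [A] to
    [d |: A]. *)
Lemma spread_extend (c : R) K H A d : 0 < c -> 0 <= K -> spread K H A -> d \notin A ->
  c * dens H A <= dens H (d |: A) ->
  spread (K * rho / c) (H :&: ext (d |: A)) (d |: A).
Proof.
move=> c0 K0 gH dA le; apply: spread_setI => D dAD.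
have AD : A \subset D by apply: subset_trans dAD; apply: subsetUr.
apply: le_trans (gH D AD) _.
have := subset_leq_card dAD; rewrite cardsU1 dA add1n => lt.
rewrite -(subnSK lt) exprS.
have -> : K * rho / c * rho ^+ (#|D| - #|A|.+1) * dens H (d |: A)
  = K * (rho * rho ^+ (#|D| - #|A|.+1)) * (c^-1 * dens H (d |: A)) by ring.
apply: ler_wpM2l; last by rewrite ler_pdivlMl.
by rewrite mulr_ge0 // -exprS exprn_ge0 // ltW ?rho_gt0.
Qed.

Lemma extend_const : 100 / 99 * rho / (49 / 100) <= 16.
Proof. by rewrite /rho; lra. Qed.

(** [A] is enlarged to make [H1] spread, [absorb] does the same for [B] and [H2], and a common cell
    enters both sets. The losses [1 / 2] in [absorb], [49 / 100] for the cell and [1 / rho] for the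
    larger set multiply to more than [1 / 8]. *)
Lemma linked_step b A B H1 H2 : small (b / 8) -> linked b A B H1 H2 ->
  exists A' B' H1' H2', [/\ H1' \subset H1, H2' \subset H2,
    #|A' :&: B'| = #|A :&: B|.+1 & linked (b / 8) A' B' H1' H2'].
Proof.
move=> sb [H1A H2B c1 c2 g1 g2 d1 d2].
have b80 := sb.1.
have b0 : 0 < b by move: b80; clear; lra.
have sb2 : small (b / 2) by apply: small_mono sb; move: b80; clear; lra.
have [A1 [AA1 dA1 gA1]] := spread_exists b0 d1.
have A1s : (1000 * #|A1| <= n)%N.
  by apply: (@small_card b _ _ (small_mono _ sb)) dA1; move: b80; clear; lra.
have /dens_gt0P[s0 s0H s0A1] := dens_ge_gt0 b0 dA1.
(* The member [s0] of [H1] contains [A1] and meets [B] only inside [A]. *)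
have A1B : A1 :&: B = A :&: B.
  apply/eqP; rewrite eqEsubset; apply/andP; split; last exact: setSI.
  rewrite subsetI subsetIr andbT; apply: subset_trans (c1 _ s0H).
  by rewrite setSI // -in_ext.
have A140 : (40 * #|A1| <= n)%N by move: A1s; clear; lia.
have [B1 [H1' [H2' [[BB1 sH1 sH2 A1B1] [H2'B1 c1' c2'] [g1' g2'] [d1' d2']]]]] :=
  absorb sb2 A140 (subsetIr _ _) H2B
    (confined_sub (subsetIl _ _) (confinedSl AA1 c1)) (spread_setI gA1) g2 d2.
rewrite dens_setI // in d1'.
have H1'A1 : H1' \subset ext A1 by apply: subset_trans sH1 (subsetIr _ _).
have B1s := small_card sb2 d2'.
have g2'' : spread (100 / 99 : R) H2' B1 by apply: spread_mono g2'; rewrite ler_pdivlMr // mul1r ler_nat.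
have p1 : (0 < #|H1'|)%N.
  have : 0 < dens H1' A1.
    by apply: lt_le_trans d1'; rewrite mulr_gt0 ?(dens_ge_gt0 b0 dA1) // divr_gt0.
  by case/dens_gt0P => s sH _; apply/card_gt0P; exists s.
have p2 : (0 < #|H2'|)%N.
  by have /dens_gt0P[u uH _] := dens_ge_gt0 sb2.1 d2'; apply/card_gt0P; exists u.
have [d dM [h1 h2]] := common_cell A1s B1s H1'A1 H2'B1 c1' c2' g1' g2'' p1 p2.
have /andP[dA dB] : (d \notin A1) && (d \notin B1) by rewrite -negb_or -in_setU.
have e1 := dens_cell A1s H1'A1 dA h1.
have e2 := dens_cell B1s H2'B1 dB h2.
have c0 : 0 < 49 / 100 :> R by rewrite divr_gt0.
have k0 : 0 <= 100 / 99 :> R by rewrite divr_ge0.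
have rE : rho = 1001 / 1000 by [].
have dens_step (C : {set 'I_n * 'I_n}) H : d \notin C -> b / 2 * rho ^+ #|C| <= dens H C ->
    49 / 100 * dens H C <= dens H (d |: C) -> b / 8 * rho ^+ #|d |: C| <= dens H (d |: C).
  move=> dC l1 l2; rewrite cardsU1 dC add1n exprS.
  have : 0 < b * rho ^+ #|C| by rewrite mulr_gt0 // exprn_gt0 ?rho_gt0.
  by move: l1 l2; set y := _ ^+ _; rewrite rE; clear; nra.
exists (d |: A1), (d |: B1), (H1' :&: ext (d |: A1)), (H2' :&: ext (d |: B1)); split.
- by apply: subset_trans (subsetIl _ _) (subset_trans sH1 (subsetIl _ _)).
- by apply: subset_trans (subsetIl _ _) sH2.
- by rewrite -setUIr cardsU1 inE (negbTE dA) A1B1 A1B.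
split.
- exact: subsetIr.
- exact: subsetIr.
- move=> s /setIP[sH _]; rewrite setIUr subUset subIset ?sub1set ?setU11 ?orbT //=.
  by apply: subset_trans (c1' _ sH) (subsetUr _ _).
- move=> s /setIP[sH _]; rewrite setIUr subUset subIset ?sub1set ?setU11 ?orbT //=.
  by apply: subset_trans (c2' _ sH) (subsetUr _ _).
- exact: spread_mono extend_const (spread_extend c0 k0 g1' dA e1).
- exact: spread_mono extend_const (spread_extend c0 k0 g2'' dB e2).
- rewrite dens_setI //; apply: dens_step => //.
  by move: dA1 d1' (dens_ge0 H1 A1); set y := _ ^+ _; clear; lra.
- by rewrite dens_setI //; apply: dens_step.
Qed.

(** * From linked pairs to an exact intersection size *)

Lemma dens_fill1 H A : 0 < dens H A -> (#|A| < n)%N ->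
  exists2 d, d \notin A & dens H A <= dens H (d |: A).
Proof.
move=> /dens_gt0P[s0 s0H]; rewrite in_ext => s0A An.
pose H' := H :&: ext A.
have H'A : H' \subset ext A := subsetIr _ _.
have [i iA] : exists i, i \notin fst @: A.
  apply/existsP; rewrite -negb_forall; apply/negP => /forallP all.
  have : (#|'I_n| <= #|fst @: A|)%N by apply/subset_leq_card/subsetP=> j _; apply: all.
  by rewrite card_ord leqNgt (leq_ltn_trans (leq_imset_card _ _)).
have cC : #|snd @: A| = #|A|.
  apply: card_in_imset => d e /(subsetP s0A) + /(subsetP s0A).
  case: d e => [d1 d2] [e1 e2]; rewrite !in_graph /= => /eqP <- /eqP <- /perm_inj ->.
  by [].
(* Every member of [H'] has its cell of the free row [i] in one of [n - #|A|] free columns; the most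
   frequent column loses no density. *)
have sum : (#|H'| <= \sum_(j in ~: (snd @: A)) #|[set s in H' | (i, j) \in graph s]|)%N.
  have sub : H' \subset \bigcup_(j in ~: (snd @: A)) [set s in H' | (i, j) \in graph s].
    apply/subsetP=> s sH; apply/bigcupP; exists (s i); last by rewrite inE sH in_graph /= eqxx.
    rewrite inE; apply: contra iA => /imsetP[d dA e].
    have := subsetP H'A s sH; rewrite in_ext => /subsetP/(_ d dA).
    by rewrite in_graph -e => /eqP/perm_inj <-; apply: imset_f.
  apply: leq_trans (subset_leq_card sub) _.
  elim/big_rec2: _ => [|j y X _ le]; first by rewrite cards0.
  by apply: leq_trans (leq_card_setU _ _) _; rewrite leq_add2l.
have H'0 : (0 < #|H'|)%N by apply/card_gt0P; exists s0; rewrite inE s0H in_ext.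
have [/existsP[j jM]|/existsPn no] :=
    boolP [exists j, #|H'| <= (n - #|A|) * #|[set s in H' | (i, j) \in graph s]|]%N.
  exists (i, j); first by apply: contra iA => /(imset_f fst).
  rewrite -(dens_setI H (subxx A)) -(dens_setI H (subsetUr [set (i, j)] A)).
  rewrite dens_setU1 //; last by apply: contra iA => /(imset_f fst).
  rewrite /dens -/H' (setIidPl H'A) ler_pM2r ?invr_gt0 ?factR_gt0 //.
  by rewrite -natrM ler_nat.
exfalso; have : ((n - #|A|) * #|H'| <= \sum_(j in ~: (snd @: A)) (#|H'| - 1))%N.
  apply: leq_trans (leq_mul (leqnn _) sum) _; rewrite big_distrr /=.
  by apply: leq_sum => j _; have := no j; rewrite -ltnNge; case: #|H'| => // m; rewrite ltnS subn1.
have cM : #|~: (snd @: A)| = (n - #|A|)%N by rewrite cardsCs setCK cC card_ord.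
rewrite sum_nat_const cM leq_pmul2l ?subn_gt0 //.
by case: #|H'| H'0 => // m _; rewrite subn1 ltnn.
Qed.

Lemma dens_fill H A m : 0 < dens H A -> (#|A| + m <= n)%N ->
  exists A', [/\ A \subset A', #|A'| = (#|A| + m)%N & dens H A <= dens H A'].
Proof.
elim: m A => [|m IH] A d0 le; first by exists A; rewrite addn0.
have An : (#|A| < n)%N by apply: leq_trans le; rewrite addnS ltnS leq_addr.
have [d dA dd] := dens_fill1 d0 An.
have [|A' [sA' cA' dA']] := IH (d |: A) (lt_le_trans d0 dd).
  by rewrite cardsU1 dA add1n addSnnS.
exists A'; split; first by apply: subset_trans sA'; apply: subsetUr.
  by rewrite cA' cardsU1 dA add1n addSnnS.
exact: le_trans dd dA'.
Qed.

Lemma linked_pair b A B H1 H2 : small (b / 2) -> linked b A B H1 H2 ->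
  exists s u, [/\ s \in H1, u \in H2 & graph s :&: graph u = A :&: B].
Proof.
move=> sb [H1A H2B c1 c2 g1 g2 d1 d2].
have b0 : 0 < b by move: sb.1; clear; lra.
have sb1 : small b by apply: small_mono sb; move: b0; clear; lra.
have As := small_card sb1 d1.
have rp m : 0 < rho ^+ m by rewrite exprn_gt0 ?rho_gt0.
have [|A0 [AA0 cA0 dA0]] := @dens_fill H1 A ((n %/ 100).+1 - #|A|) (dens_ge_gt0 b0 d1).
  by move: As n_big; clear; lia.
have {}cA0 : #|A0| = (n %/ 100).+1 by rewrite cA0; move: As n_big; clear; lia.
(* [A0] is too large for [small] to apply to its supersets directly. With this [b'] the power
   [rho ^+ #|A0|] cancels, and [small] bounds [#|A1| - #|A0|] by [n / 1000]. *)
pose b' := b * rho ^+ #|A| / rho ^+ #|A0|.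
have b'0 : 0 < b' by rewrite divr_gt0 ?mulr_gt0.
have [|A1 [A01 dA1 gA1]] := @spread_exists b' H1 A0 b'0.
  by rewrite /b' divfK ?lt0r_neq0 // (le_trans d1).
have cA01 := subset_leq_card A01.
have A1s : (1000 * (#|A1| - #|A0|) <= n)%N.
  apply: sb1.2; apply: le_trans (dens_le1 H1 A1); apply: le_trans dA1.
  rewrite /b' -[in leRHS](subnK cA01) exprD [leRHS]mulrA [leRHS]mulrAC divfK ?lt0r_neq0 //.
  by rewrite mulrAC ler_peMr ?exprn_ege1 ?rho_ge1 // ltW ?mulr_gt0.
have AA1 := subset_trans AA0 A01.
have /dens_gt0P[s0 s0H s0A1] := dens_ge_gt0 b'0 dA1.
have A1B : A1 :&: B = A :&: B.
  apply/eqP; rewrite eqEsubset; apply/andP; split; last exact: setSI.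
  rewrite subsetI subsetIr andbT; apply: subset_trans (c1 _ s0H).
  by rewrite setSI // -in_ext.
have A140 : (40 * #|A1| <= n)%N by move: A1s cA0 cA01 n_big; clear; lia.
have [B1 [H1' [H2' [[BB1 sH1 sH2 A1B1] [H2'B1 c1' c2'] [g1' g2'] [d1' d2']]]]] :=
  absorb sb A140 (subsetIr _ _) H2B
    (confined_sub (subsetIl _ _) (confinedSl AA1 c1)) (spread_setI gA1) g2 d2.
rewrite dens_setI // in d1'.
have B1s := small_card sb d2'.
have : 0 < dens H1' A1.
  by apply: lt_le_trans d1'; rewrite mulr_gt0 ?(dens_ge_gt0 b'0 dA1) // divr_gt0.
case/dens_gt0P => s sH sA1; rewrite in_ext in sA1.
pose S := graph s :\: (A1 :|: B1).
have SB : [disjoint S & B1].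
  by apply/pred0P=> d /=; rewrite !inE negb_or; case: (d \in B1); rewrite ?andbF.
have cS : (#|S| <= n - #|A1|)%N.
  have -> : (n - #|A1| = #|graph s :\: A1|)%N.
    by rewrite cardsD card_graph (setIidPr sA1).
  by apply/subset_leq_card/setDS/subsetUl.
have := card_avoiding H2'B1 g2' SB; rewrite mul1r => cav.
have p2 : 0 < #|H2'|%:R :> R.
  have /dens_gt0P[u uH _] := dens_ge_gt0 sb.1 d2'; rewrite ltr0n.
  by apply/card_gt0P; exists u.
(* The expected number of cells of [S] used by [H2'] is at most [0.99 * rho / 0.999 < 1]. *)
have : 0 < ((n - #|B1|)%:R - #|S|%:R * rho) * #|H2'|%:R.
  rewrite mulr_gt0 // subr_gt0 /rho.
  have h1 : (100 * #|S|)%:R <= (99 * n)%:R :> R.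
    by rewrite ler_nat; move: cS cA0 cA01 n_big; clear; lia.
  have h2 : (999 * n)%:R <= (1000 * (n - #|B1|))%:R :> R by rewrite ler_nat; move: B1s; clear; lia.
  have n0 : 0 < n%:R :> R by rewrite ltr0n; move: n_big; clear; lia.
  by rewrite !natrM in h1 h2; move: h1 h2 n0; clear; lra.
move=> /lt_le_trans/(_ cav) pos.
have [u uH] : exists u, u \in avoiding S H2'.
  apply/set0Pn; rewrite -card_gt0 -(ltr0n R); apply: contraTT pos; rewrite -!leNgt => h.
  by rewrite mulr_ge0_le0.
have [uH2' uS] := setIdP uH.
have sH1m := subsetP sH1 s sH; have [sH10 _] := setIP sH1m.
exists s, u; split=> //; first exact: (subsetP sH2).
apply/setP=> d; apply/idP/idP => [/setIP[ds du]|/setIP[dA dB]].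
  rewrite -A1B -A1B1.
  have : d \in A1 :|: B1.
    by apply: contraTT uS => dn; apply/pred0Pn; exists d; rewrite /= du inE dn ds.
  have dBA : d \in B1 -> d \in A1.
    by move=> dB; apply: (subsetP (c1' s sH)); rewrite inE ds.
  rewrite inE => dAB; have dA : d \in A1 by case/orP: dAB.
  by rewrite inE dA; apply: (subsetP (c2' u uH2')); rewrite inE du.
have := subsetP H1A s sH10; have := subsetP H2B u (subsetP sH2 _ uH2').
rewrite !in_ext inE => /subsetP-> // /subsetP -> //.
Qed.

Lemma linked_exact k b A B H1 H2 : small (b / 8 ^+ k / 2) -> linked b A B H1 H2 ->
  exists s u, [/\ s \in H1, u \in H2 & #|graph s :&: graph u| = (#|A :&: B| + k)%N].
Proof.
elim: k b A B H1 H2 => [|k IH] b A B H1 H2.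
  rewrite expr0 divr1 addn0 => sb lk; have [s [u [sH uH e]]] := linked_pair sb lk.
  by exists s, u; rewrite e.
move=> sb lk.
have sb8 : small (b / 8).
  have := sb.1; rewrite -mulrA pmulr_lgt0 => [b0|]; last by rewrite mulr_gt0 // invr_gt0 // exprn_gt0.
  have p8 : 0 < 8 ^+ k :> R by rewrite exprn_gt0.
  have e : b / 8 ^+ k.+1 / 2 = b / 8 / (8 ^+ k * 2).
    by rewrite exprS; field; rewrite lt0r_neq0.
  apply: small_mono sb; rewrite e ler_piMr ?divr_ge0 ?(ltW b0) //.
  by rewrite invf_le1 ?mulr_gt0 // mulr_ege1 ?exprn_ege1 // ler1n.
have [A' [B' [H1' [H2' [sH1 sH2 cAB lk']]]]] := linked_step sb8 lk.
have [|s [u [sH uH e]]] := IH _ _ _ _ _ _ lk'; first by rewrite exprS invfM mulrA in sb.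
exists s, u; split; [exact: (subsetP sH1) | exact: (subsetP sH2) | ].
by rewrite e cAB addSnnS.
Qed.

(** Making [H1] avoid [B :\: A] and [H2] avoid [A :\: B] at most halves the densities and doubles
    the slack 8 to the 16 of [linked]; then [t - #|A :&: B|] common cells are added at a factor 8
    each. *)
Theorem exact_intersection b t A B H1 H2 : small (b / (4 * 8 ^+ t)) ->
    H1 \subset ext A -> H2 \subset ext B -> spread (8 : R) H1 A -> spread (8 : R) H2 B ->
    b * rho ^+ #|A| <= dens H1 A -> b * rho ^+ #|B| <= dens H2 B ->
    (#|A :&: B| <= t)%N ->
  exists s u, [/\ s \in H1, u \in H2 & #|graph s :&: graph u| = t].
Proof.
move=> sb H1A H2B g1 g2 d1 d2 ABt.
have p8 m : 0 < 8 ^+ m :> R by rewrite exprn_gt0.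
have b0 : 0 < b by have := sb.1; rewrite pmulr_lgt0 // invr_gt0 mulr_gt0.
have sb1 : small b.
  apply: small_mono sb; rewrite ler_piMr ?(ltW b0) // invf_le1 ?mulr_gt0 //.
  by rewrite mulr_ege1 ?exprn_ege1 // ler1n.
have As := small_card sb1 d1; have Bs := small_card sb1 d2.
have half0 : 0 < 1 / 2 :> R by rewrite divr_gt0.
have le (C D : {set 'I_n * 'I_n}) : (1000 * #|C| <= n)%N -> (1000 * #|D| <= n)%N ->
    #|C :\: D|%:R * (8 * rho) <= (1 - 1 / 2) * (n - #|D|)%:R :> R.
  move=> Cs Ds; have le : (#|C :\: D| <= #|C|)%N by rewrite subset_leq_card ?subsetDl.
  have h1 : (1000 * #|C :\: D|)%:R <= n%:R :> R by rewrite ler_nat; move: le Cs; clear; lia.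
  have h2 : (999 * n)%:R <= (1000 * (n - #|D|))%:R :> R by rewrite ler_nat; move: Ds; clear; lia.
  have n0 : 0 < n%:R :> R by rewrite ltr0n; move: n_big; clear; lia.
  by rewrite !natrM in h1 h2; rewrite /rho; move: h1 h2 n0; clear; lra.
have An : (#|A| < n)%N by move: As n_big; clear; lia.
have Bn : (#|B| < n)%N by move: Bs n_big; clear; lia.
have [d1' g1'] := spread_avoiding half0 (ler0n R 8) H1A g1 (disjointD A B) An (le _ _ Bs As).
have [d2' g2'] := spread_avoiding half0 (ler0n R 8) H2B g2 (disjointD B A) Bn (le _ _ As Bs).
have lk : linked (b / 2) A B (avoiding (B :\: A) H1) (avoiding (A :\: B) H2).
  split.
  - exact: subset_trans (avoiding_sub _ _) H1A.
  - exact: subset_trans (avoiding_sub _ _) H2B.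
  - exact: confined_avoiding.
  - exact: confined_avoiding.
  - by apply: spread_mono g1'; rewrite ler_pdivrMr //; lra.
  - by apply: spread_mono g2'; rewrite ler_pdivrMr //; lra.
  - by move: d1 d1'; set y := _ ^+ _; clear; lra.
  - by move: d2 d2'; set y := _ ^+ _; clear; lra.
have [|s [u [sH uH e]]] := @linked_exact (t - #|A :&: B|) _ _ _ _ _ _ lk.
  set k := (t - _)%N.
  have -> : b / 2 / 8 ^+ k / 2 = b / (4 * 8 ^+ k) by field; rewrite lt0r_neq0.
  apply: small_mono sb; rewrite ler_wpM2l ?(ltW b0) // lef_pV2 ?posrE ?mulr_gt0 //.
  by rewrite ler_pM2l // ler_weXn2l ?leq_subr // ler1n.
exists s, u; split; last by rewrite e subnKC.
  exact: (subsetP (avoiding_sub _ _) _ sH).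
exact: (subsetP (avoiding_sub _ _) _ uH).
Qed.

(** * Stability for families avoiding agreements of size [t - 1] *)

Variables (t : nat) (F : {set 'S_n}).
Hypothesis t_gt0 : (0 < t)%N.
Hypothesis t_small : (1000 * t <= n)%N.
Hypothesis small_n : small (n%:R ^+ (4 * t))^-1.
Hypothesis avF : avoids_intersection (t - 1)%N F.
Implicit Types (M W : {set {set 'I_n * 'I_n}}).

Let cosetR : R := ((n - t)`!)%:R.
Let eps : R := 1 / (2 * (100 * t%:R) ^+ t).
(** The density at the empty set of a family with [eps * (n - t)!] members. *)
Let beta : R := eps * cosetR / (n`!)%:R.

Let cosetR_gt0 : 0 < cosetR. Proof. by rewrite ltr0n fact_gt0. Qed.
Let t0 : 1 <= t%:R :> R. Proof. by rewrite ler1n. Qed.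

Let eps_gt0 : 0 < eps.
Proof. by rewrite divr_gt0 ?mulr_gt0 ?exprn_gt0 ?mulr_gt0 ?ltr0n. Qed.

Let eps_le : eps <= 1 / 200.
Proof.
have p : 0 < (100 * t%:R) ^+ t :> R by rewrite exprn_gt0 ?mulr_gt0 ?ltr0n.
rewrite /eps !mul1r lef_pV2 ?posrE //; last exact: mulr_gt0.
have h : 100 <= 100 * t%:R :> R by rewrite ler_peMr.
have -> : 200 = 2 * 100 :> R by rewrite -natrM.
rewrite ler_pM2l // (le_trans h) // ler_eXnr //.
by apply: le_trans h; rewrite ler1n.
Qed.

Let beta_gt0 : 0 < beta. Proof. exact: divr_gt0 (mulr_gt0 eps_gt0 cosetR_gt0) (factR_gt0 n). Qed.

Let fact_n : (n`! <= n ^ t * (n - t)`!)%N.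
Proof.
have tn : (t <= n)%N by move: t_small; clear; lia.
by rewrite -(ffact_fact tn) leq_mul2r ffact_le_exp orbT.
Qed.

(** By [n! <= n ^ t * (n - t)!] the argument of [small] is at least [1 / (800 * t * n) ^ t], and
    [800 * t <= n ^ 3]. *)
Let small_beta : small (beta / (4 * 8 ^+ (t - 1))).
Proof.
apply: small_mono small_n.
have nf0 : 0 < (n`!)%:R :> R := factR_gt0 n.
have p100 : 0 < (100 * t%:R) ^+ t :> R by rewrite exprn_gt0 ?mulr_gt0 ?ltr0n.
have e : beta / (4 * 8 ^+ (t - 1)) = cosetR / ((8 ^+ t * (100 * t%:R) ^+ t) * (n`!)%:R).
  have -> : 8 ^+ t = 8 * 8 ^+ (t - 1) :> R by rewrite -exprS subn1 prednK.
  have p8 : 0 < 8 ^+ (t - 1) :> R by rewrite exprn_gt0.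
  rewrite /beta /eps; move: p100 p8 nf0; set y := _ ^+ t; set z := _ ^+ _; set N := _%:R => p1 p2 p3.
  by field; rewrite !lt0r_neq0.
have p8 : 0 < 8 ^+ t :> R by rewrite exprn_gt0.
rewrite e ler_pdivlMr; last exact: mulr_gt0 (mulr_gt0 p8 p100) nf0.
rewrite ler_pdivrMl; last by rewrite exprn_gt0 // ltr0n; move: n_big; clear; lia.
rewrite -natrX -(natrM _ 100) -!natrX -!natrM ler_nat.
apply: leq_trans (leq_mul (leqnn _) fact_n) _.
rewrite !mulnA leq_mul2r; apply/orP; right.
rewrite -!expnMn expnM leq_exp2r //.
have tn : (t <= n)%N by move: t_small; clear; lia.
have : (n * n * n * n = n ^ 4)%N by rewrite !expnS expn0 muln1 !mulnA.
move=> <-; rewrite leq_mul2r; apply/orP; right; rewrite mulnA leq_mul //.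
move: n_big; clear; nia.
Qed.

(** A boolean, so that the sets [A] at which a large part of [F] is spread can be collected in [M].
    The slack 8 lets [F] itself qualify at [T], where [dens F T >= 1 / 2]. *)
Let big (H : {set 'S_n}) (A : {set 'I_n * 'I_n}) :=
  [&& H \subset F, beta * rho ^+ #|A| <= dens H A &
      [forall (D : {set 'I_n * 'I_n} | A \subset D),
         dens H D <= 8 * rho ^+ (#|D| - #|A|) * dens H A]].

(** Otherwise [exact_intersection] would produce members of [F] that agree in [t - 1] cells. *)
Let big_meet H1 H2 A B : big H1 A -> big H2 B -> (t <= #|A :&: B|)%N.
Proof.
move=> /and3P[H1F d1 /forall_inP g1] /and3P[H2F d2 /forall_inP g2].
rewrite leqNgt; apply/negP => lt.
have [|||||s [u [/setIP[sH _] /setIP[uH _] e]]] :=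
  @exact_intersection beta (t - 1) A B (H1 :&: ext A) (H2 :&: ext B) small_beta
    (subsetIr _ _) (subsetIr _ _).
- exact: spread_setI.
- exact: spread_setI.
- by rewrite dens_setI.
- by rewrite dens_setI.
- by move: lt t_gt0; clear; lia.
apply: (avF (subsetP H1F s sH) (subsetP H2F u uH)).
by rewrite card_agreement.
Qed.

Let big_exists H : H \subset F -> eps * cosetR <= #|H|%:R ->
  exists2 A, big H A & exists2 s, s \in H & s \in ext A.
Proof.
move=> HF le.
have [|A [_ dA gA]] := @spread_exists beta H set0 beta_gt0.
  rewrite cards0 expr0 mulr1 /beta /dens cards0 subn0 ler_pM2r ?invr_gt0 ?factR_gt0 //.
  rewrite (_ : H :&: ext set0 = H) //.
  by apply/setIidPl/subsetP => s _; rewrite in_ext sub0set.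
exists A; last by apply/dens_gt0P; apply: dens_ge_gt0 beta_gt0 dA.
rewrite /big HF dA; apply/forall_inP => D AD.
by apply: (spread_mono _ gA) => //; rewrite ler1n.
Qed.

Definition uncovered M := [set s in F | [forall A in M, ~~ (A \subset graph s)]].

(** By [peel_fact], peeling at size [t + j] uncovers at most [cosetR / 2 ^ (j + 2)] more
    permutations; over [j = h, ..., 1] this is a geometric series of total below [cosetR / 4]. *)
Lemma peel_iter h M : intersecting t M -> (forall A, A \in M -> (#|A| <= t + h)%N) ->
    (65 * (t + h) <= n)%N ->
  exists M', [/\ intersecting t M', (forall A, A \in M' -> (#|A| <= t)%N) &
    #|uncovered M'|%:R <= #|uncovered M|%:R + 1 / 4 * (1 - (2 ^+ h)^-1) * cosetR].
Proof.
elim: h M => [|h IH] M iM leM le.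
  exists M; split=> // [A /leM|]; first by rewrite addn0.
  by rewrite expr0 invr1 subrr mulr0 mul0r addr0.
have [|M1 [W [iM1 leM1 kW cW cov]]] := peel iM leM; first by rewrite addnS ltnS leq_addr.
have [||M' [iM' leM' cM']] := IH M1 iM1.
- by move=> A /leM1; rewrite addnS ltnS.
- by move: le; clear; lia.
exists M'; split=> //; apply: le_trans cM' _.
have sub : uncovered M1 \subset uncovered M :|: \bigcup_(U in W) ext U.
  apply/subsetP=> s /setIdP[sF /forall_inP no]; rewrite in_setU inE sF /=.
  have [//|] := boolP [forall A in M, ~~ (A \subset graph s)].
  rewrite negb_forall_in => /exists_inP[A AM]; rewrite negbK => As.
  have [U UMW UA] := cov A AM; apply/bigcupP; exists U; last by rewrite in_ext (subset_trans UA).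
  by move: UMW => /setUP[/no|//]; rewrite (subset_trans UA As).
have c1 : (#|uncovered M1| <= #|uncovered M| + #|W| * (n - (t + h.+1))`!)%N.
  apply: leq_trans (subset_leq_card sub) _; apply: leq_trans (leq_card_setU _ _) _.
  rewrite leq_add2l -sum_nat_const.
  elim/big_rec2: _ => [|U y Y UW le']; first by rewrite cards0.
  apply: leq_trans (leq_card_setU _ _) _; rewrite leq_add // -(kW U UW).
  exact: card_ext_le.
have c2 := peel_fact le (ltn0Sn h).
have p2 : 0 < 2 ^+ h :> R by rewrite exprn_gt0.
have c3 : #|W|%:R * ((n - (t + h.+1))`!)%:R * (8 * 2 ^+ h) <= cosetR.
  rewrite (_ : 8 * 2 ^+ h = (2 ^ (h.+1 + 2))%N%:R) -?natrM ?ler_nat; last first.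
    by rewrite natrX addn2 !exprS !mulrA -!natrM.
  apply: leq_trans c2; rewrite leq_mul2r leq_mul2r.
  by move: cW; rewrite addKn => ->; rewrite !orbT.
have c4 : #|uncovered M1|%:R <= #|uncovered M|%:R + #|W|%:R * ((n - (t + h.+1))`!)%:R :> R.
  by rewrite -natrM -natrD ler_nat.
rewrite exprS invfM.
have c5 : #|W|%:R * ((n - (t + h.+1))`!)%:R <= 1 / 8 * (2 ^+ h)^-1 * cosetR.
  rewrite -(ler_pM2r (_ : 0 < 8 * 2 ^+ h)) ?mulr_gt0 //.
  apply: le_trans c3 _; rewrite le_eqVlt; apply/orP; left; apply/eqP.
  by field; rewrite lt0r_neq0.
by move: c4 c5; set y := (2 ^+ h)^-1; lra.
Qed.

Lemma avoiding_stability :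
  (1 - 1 / (2 * (100 * t%:R) ^+ t)) * ((n - t)`!)%:R < #|F|%:R :> R ->   exists2 T : {set 'I_n * 'I_n}, #|T| = t & F \subset ext T.
Proof.
rewrite -/cosetR -/eps => Fbig.
pose M := [set A | [exists H : {set 'S_n}, big H A]].
have iM : intersecting t M.
  by move=> A B; rewrite !inE => /existsP[H1 b1] /existsP[H2 b2]; apply: big_meet b1 b2.
(* The largest [h] allowed by [65 * (t + h) <= n]; the sets of [M] have at most [n / 1000] cells,
   well within [t + h]. *)
pose h := (n %/ 65 - t)%N.
have leM (A : {set 'I_n * 'I_n}) : A \in M -> (#|A| <= t + h)%N.
  rewrite inE => /existsP[H /and3P[_ d _]].
  have p8 : 0 < 4 * 8 ^+ (t - 1) :> R by rewrite mulr_gt0 ?exprn_gt0.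
  have sb : small beta.
    apply: small_mono small_beta; rewrite ler_piMr ?(ltW beta_gt0) // invf_le1 //.
    by rewrite mulr_ege1 ?exprn_ege1 // ler1n.
  have := small_card sb d; rewrite /h; move: t_small; clear.
  by move: #|A| => a; lia.
have [|M' [iM' leM' uM']] := peel_iter iM leM.
  by rewrite /h; move: t_small; clear; lia.
(* A larger uncovered part would be spread at some [A] in [M], and one of its members would contain
   [A]. *)
have uM : #|uncovered M|%:R < eps * cosetR.
  rewrite ltNge; apply/negP => le.
  have [|A bA [s /setIdP[sF /forall_inP no] sA]] := @big_exists (uncovered M) _ le.
    by apply/subsetP=> s /setIdP[].
  have := no A; rewrite in_ext in sA; rewrite sA => /(_ _)/negP; case=> //.
  by rewrite inE; apply/existsP; exists (uncovered M).
have uM'' : #|uncovered M'|%:R <= (eps + 1 / 4) * cosetR.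
  have : 0 <= (2 ^+ h)^-1 * cosetR by rewrite mulr_ge0 ?invr_ge0 ?exprn_ge0 // ltW.
  by move: uM uM'; set y := (2 ^+ h)^-1; lra.
have [T TM'] : exists T, T \in M'.
  apply/set0Pn; apply/negP => /eqP M0.
  have : uncovered M' = F.
    by apply/setP=> s; rewrite inE M0; case: (s \in F) => //=; apply/forall_inP => A; rewrite inE.
  move=> e; rewrite e in uM''.
  have := ler_wpM2r (ltW cosetR_gt0) eps_le.
  by move: uM'' Fbig cosetR_gt0; lra.
have cT : #|T| = t.
  by apply/eqP; rewrite eqn_leq leM' //=; have := iM' _ _ TM' TM'; rewrite setIid.
have FT : F :\: ext T \subset uncovered M'.
  apply/subsetP=> s /setDP[sF sT]; rewrite inE sF; apply/forall_inP => A AM'.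
  have -> : A = T; last by rewrite -in_ext.
  have h1 : A :&: T = T by apply/eqP; rewrite eqEcard subsetIr cT iM'.
  by apply/eqP; rewrite eq_sym eqEcard cT leM' // andbT; apply/setIidPr.
have cF : #|F|%:R = #|F :&: ext T|%:R + #|F :\: ext T|%:R :> R by rewrite -natrD cardsID.
have FTle : #|F :\: ext T|%:R <= #|uncovered M'|%:R :> R by rewrite ler_nat subset_leq_card.
have half : 1 / 2 * cosetR <= #|F :&: ext T|%:R.
  have := ler_wpM2r (ltW cosetR_gt0) eps_le.
  by move: cF FTle Fbig uM'' cosetR_gt0; lra.
have dT : 1 / 2 <= dens F T by rewrite /dens cT ler_pdivlMr // factR_gt0.
have rho0 m : 0 < rho ^+ m by rewrite exprn_gt0 ?rho_gt0.
have bT : big F T.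
  rewrite /big subxx /=; apply/andP; split.
    rewrite cT; apply: le_trans dT; rewrite /beta.
    have h1 : (cosetR * rho ^+ t) <= (n`!)%:R.
      have tn : (t <= n)%N by move: t_small; clear; lia.
      rewrite -(ffact_fact tn) natrM mulrC ler_wpM2r ?(ltW cosetR_gt0) //.
      apply: (@le_trans _ _ ((n - t) ^ t)%N%:R); last by rewrite ler_nat ffact_ge_exp.
      rewrite natrX lerXn2r ?nnegrE ?(ltW rho_gt0) ?ler0n //.
      apply: (@le_trans _ _ 2%:R); first by rewrite /rho; lra.
      by rewrite ler_nat; move: t_small n_big; clear; lia.
    have -> : eps * cosetR / (n`!)%:R * rho ^+ t = eps * ((cosetR * rho ^+ t) / (n`!)%:R) by ring.
    apply: (@le_trans _ _ (eps * 1)).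
      by rewrite ler_pM2l // ler_pdivrMr ?factR_gt0 // mul1r.
    by move: eps_le; lra.
  apply/forall_inP => D TD; apply: le_trans (dens_le1 F D) _.
  have h1 : 1 <= rho ^+ (#|D| - #|T|) by rewrite exprn_ege1 ?rho_ge1.
  have h2 : 1 * (1 / 2) <= rho ^+ (#|D| - #|T|) * dens F T.
    by apply: ler_pM => //; rewrite divr_ge0.
  by rewrite -mulrA; move: h2; set y := rho ^+ _ * _; lra.
have rest : #|F :\: ext T|%:R < eps * cosetR.
  rewrite ltNge; apply/negP => le.
  have [|A bA [s /setDP[sF sT] sA]] := @big_exists (F :\: ext T) _ le.
    exact: subsetDl.
  have : T \subset A.
    have h1 : (t <= #|T :&: A|)%N by apply: big_meet bT bA.
    by apply/setIidPl/eqP; rewrite eqEcard subsetIl cT.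
  by move/extS/subsetP/(_ s sA); rewrite (negbTE sT).
exists T => //; apply/negPn/negP => /subsetPn[s sF sT].
have [v vFT] : exists v, v \in F :&: ext T.
  apply/set0Pn; rewrite -card_gt0 -(ltr0n R); apply: lt_le_trans half.
  by rewrite mulr_gt0 ?divr_gt0.
have [vF vT] := setIP vFT.
(* The number of cells outside [T] that a permutation through [T] must share with [s] to agree with
   it in exactly [t - 1] cells. *)
pose k := (t - 1 - #|T :&: graph s|)%N.
have lt : (#|T :&: graph s| < t)%N.
  rewrite -cT proper_card // properEneq subsetIl andbT.
  by apply: contra sT => /eqP/setIidPl; rewrite in_ext.
pose Bad := [set w in ext T | #|(graph w :&: graph s) :\: T| == k].
have badF : F :&: ext T \subset ext T :\: Bad.
  apply/subsetP=> w /setIP[wF wT]; rewrite inE wT andbT; apply/negP => /setIdP[_ /eqP wk].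
  apply: (avF wF sF); rewrite card_agreement -(cardsID T) wk.
  have -> : graph w :&: graph s :&: T = T :&: graph s.
    by rewrite in_ext in wT; rewrite setIAC (setIidPr wT).
  by rewrite /k; move: lt t_gt0; clear; lia.
have BT : Bad \subset ext T by apply/subsetP=> w /setIdP[].
have := subset_leq_card badF; rewrite cardsD (setIidPr BT) (card_ext_eq vT) cT => le1.
have sBad : (#|Bad| <= (n - t)`!)%N.
  by rewrite -cT -(card_ext_eq vT) subset_leq_card.
have := @hit_count n s k T v vT; rewrite cT -/Bad => hc.
have {}hc : ((n - t)`! <= (100 * t) ^ t * #|Bad|)%N.
  apply: leq_trans (hc _ _) _.
  - by rewrite /k; move: t_small; clear; lia.
  - by move: n_big; clear; lia.
  rewrite leq_mul2r; apply/orP; right.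
  have kt : (k <= t - 1)%N by rewrite /k leq_subr.
  have -> : ((100 * t) ^ t = (100 * t) * (100 * t) ^ (t - 1))%N.
    by rewrite -expnS subn1 prednK.
  rewrite leq_mul //; first by move: t_gt0; clear; lia.
  apply: (@leq_trans ((100 * t) ^ k)%N); last by rewrite leq_pexp2l // muln_gt0 t_gt0.
  have aux m : (m <= t -> 2 ^ m * m`! <= 100 ^ m * t ^ m)%N.
    case: m => // m mt; rewrite leq_mul //; first by rewrite leq_exp2r.
    by rewrite -ffactnn; apply: leq_trans (ffact_le_exp _ _) _; rewrite leq_exp2r.
  by rewrite expnMn; apply: aux; move: kt; clear; lia.
(* [eps] is half of the share [1 / (100 * t) ^ t] that [Bad] takes of [ext T]: [F] misses
   [2 * eps * cosetR] permutations there, has fewer than [eps * cosetR] outside, and so falls below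
   the threshold. *)
have hcR : 2 * (eps * cosetR) <= #|Bad|%:R.
  have p : 0 < (100 * t%:R) ^+ t :> R by rewrite exprn_gt0 ?mulr_gt0 ?ltr0n.
  have -> : 2 * (eps * cosetR) = cosetR / (100 * t%:R) ^+ t by rewrite /eps; field; rewrite lt0r_neq0.
  rewrite ler_pdivrMr // mulrC -(natrM _ 100) -natrX -natrM ler_nat.
  exact: hc.
have le2 : #|F :&: ext T|%:R <= cosetR - #|Bad|%:R by rewrite -natrB // ler_nat.
by move: le2 hcR rest cF Fbig; lra.
Qed.

End Spread.

(** * The constant [c] and the final statement *)

Lemma ln_ge1BV (R : realType) (y : R) : 0 < y -> 1 - y^-1 <= ln y.
Proof.
move=> y0; have h : -1 < y^-1 - 1 by rewrite ltrBrDr addNr invr_gt0.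
have := le_ln1Dx h; rewrite addrCA subrr addr0 lnV ?posrE //.
lra.
Qed.

(** An enumeration of [T] supplies both sequences; a permutation through [T] shows that no row or
    column repeats. *)
Lemma ext_perms_through n t (T : {set 'I_n * 'I_n}) s : #|T| = t -> s \in ext T ->
  exists i j : 'I_t -> 'I_n, [/\ injective i, injective j & ext T = perms_through i j].
Proof.
move=> cT sT; pose d (k : 'I_t) := enum_val (cast_ord (esym cT) k).
have dT k : d k \in T by apply: enum_valP.
have dI : injective d by move=> k l /enum_val_inj/cast_ord_inj.
have sd k : s (d k).1 = (d k).2.
  by move: sT; rewrite in_ext => /subsetP/(_ _ (dT k)); rewrite in_graph => /eqP.
have ij k l : (d k).1 = (d l).1 -> k = l.
  move=> e; apply: dI; rewrite [LHS]surjective_pairing [RHS]surjective_pairing.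
  by rewrite -!sd e.
exists (fun k => (d k).1), (fun k => (d k).2); split.
- exact: ij.
- by move=> k l e; apply/ij/(@perm_inj _ s); rewrite !sd.
apply/setP=> u; rewrite in_ext inE; apply/subsetP/forallP => [uT k|uT e eT].
  by have := uT _ (dT k); rewrite in_graph.
pose k := cast_ord cT (enum_rank_in eT e).
have -> : e = d k by rewrite /d /k cast_ordK enum_rankK_in.
by rewrite in_graph.
Qed.

Theorem corollary3 (R : realType) :
  exists c : R, 0 < c /\
  forall n t : nat, (2 <= n)%N -> (1 <= t)%N ->
  t%:R <= c * (n%:R / ln n%:R) ->
  forall F : {set 'S_n}, avoids_intersection (t - 1)%N F ->
  (#|F| <= (n - t)`!)%N /\
  ((1 - 1 / (2 * (100 * t%:R) ^+ t)) * ((n - t)`!)%:R < #|F|%:R :> R ->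
   exists i j : 'I_t -> 'I_n,
     [/\ injective i, injective j & F \subset perms_through i j]).
Proof.
(* [rho ^+ m <= n ^ (4 t)] and [ln rho >= 1 / 1001] give [m <= 4004 * t * ln n], which this [c]
   brings below [n / 1000]. *)
pose c : R := 1 / 5000 / 1000.
have c0 : 0 < c by rewrite !divr_gt0.
exists c; split=> // n t n2 t1 tc F avF.
have n0 : 0 < n%:R :> R by rewrite ltr0n (leq_trans _ n2).
have lnn : 1 / 2 <= ln n%:R :> R.
  apply: le_trans (ln_ge1BV n0).
  have : n%:R^-1 <= 2^-1 :> R by rewrite lef_pV2 ?posrE // ler_nat.
  by lra.
have {}tc : t%:R * ln n%:R <= c * n%:R.
  have l0 : 0 < ln n%:R :> R by apply: lt_le_trans lnn; rewrite divr_gt0.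
  by rewrite -ler_pdivlMr // -mulrA.
(* Since [ln n >= 1 / 2], the bound on [t >= 1] forces [n] to be large. *)
have tn : 2500 * 1000 * t%:R <= n%:R :> R.
  have : t%:R * (1 / 2) <= t%:R * ln n%:R :> R by rewrite ler_wpM2l.
  by move: tc; rewrite /c; lra.
have t_small : (1000 * t <= n)%N.
  rewrite -(ler_nat R) natrM; have := ler0n R t; by lra.
have n_big : (1000 <= n)%N by move: t_small t1; clear; lia.
have small_n : small n ((n%:R ^+ (4 * t))^-1 : R).
  split; first by rewrite invr_gt0 exprn_gt0.
  move=> m; rewrite mulrC ler_pdivrMr ?exprn_gt0 // mul1r => le.
  have : ln (rho R ^+ m) <= ln (n%:R ^+ (4 * t)).
    by rewrite ler_ln ?posrE ?exprn_gt0 ?rho_gt0.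
  rewrite !lnXn ?rho_gt0 // -[leLHS]mulr_natl -[leRHS]mulr_natl natrM => le2.
  have lr : m%:R * (1 / 1001) <= m%:R * ln (rho R).
    rewrite ler_wpM2l //; apply: le_trans (ln_ge1BV (rho_gt0 R)).
    by rewrite /rho invf_div; lra.
  rewrite -(ler_nat R) natrM.
  by move: le2 lr tc; rewrite /c; lra.
have stab := avoiding_stability n_big t1 t_small small_n avF.
split=> [|/stab[T cT FT]].
  (* A family larger than [(n - t)!] passes the stability threshold, so it lies in some [ext T],
     which is too small. *)
  rewrite leqNgt; apply/negP => lt.
  have [|T cT FT] := stab.
    apply: (@lt_trans _ _ ((n - t)`!)%:R); last by rewrite ltr_nat.
    rewrite gtr_pMl ?factR_gt0 // gtrBl.
    by rewrite divr_gt0 ?mulr_gt0 ?exprn_gt0 ?mulr_gt0 ?ltr0n.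
  have := leq_trans (subset_leq_card FT) (card_ext_le T).
  by rewrite cT leqNgt lt.
(* If [F] is empty, no permutation through [T] is at hand, and any injections will do. *)
have [F0|[s sF]] := set_0Vmem F.
  pose i (k : 'I_t) : 'I_n := widen_ord (leq_trans (leq_pmull t (isT : 0 < 1000)%N) t_small) k.
  have ii : injective i by move=> k l /(congr1 val) /= /val_inj.
  by exists i, i; split=> //; rewrite F0 sub0set.
have [i [j [ii jj e]]] := ext_perms_through cT (subsetP FT s sF).
by exists i, j; split=> //; rewrite -e.
Qed.
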